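(* Let $\mathbf{q}_n(\boldsymbol{\beta})=\sum_{i=1}^n\mathbf{u}_i(\boldsymbol{\beta})$, $\boldsymbol{\beta}\in\mathcal{T}$, $n\ge1$, be $p$-dimensional random functions, continuously differentiable with respect to $\boldsymbol{\beta}$, such that $\mathbf{q}_n=\mathbf{q}_n(\boldsymbol{\beta}_0)$, $n\ge1$, is a square integrable $(\mathcal{F}_n)$-martingale with mean $0$ and a.s. positive definite conditional variance $\mathbf{V}_n=\sum_{i=1}^n\mathrm{E}(\mathbf{u}_i\mathbf{u}_i^T|\mathcal{F}_{i-1})$, where $\mathbf{u}_i=\mathbf{u}_i(\boldsymbol{\beta}_0)$. Let $\mathcal{D}_n(\boldsymbol{\beta})=-\partial\mathbf{q}_n(\boldsymbol{\beta})/\partial\boldsymbol{\beta}^T$ and $\mathcal{D}_n=\mathcal{D}_n(\boldsymbol{\beta}_0)$. Assume: $(I)$ $\lambda_{\min}[\mathbf{V}_n]\to\infty$ a.s.; $(S)$ there exist a constant $\delta>0$, a random variable $c_0>0$ a.s., a random integer $n_1\ge1$ and a random number $r_1>0$ a.s., such that (i) a.s., $|\lambda^T\mathcal{D}_n(\boldsymbol{\beta})\lambda|>0$ for all $\lambda\in\mathbb{R}^p$ with $\|\lambda\|=1$, all $\boldsymbol{\beta}\in B_{r_1}$ and all $n\ge n_1$; (ii) $\lim_{r\to0}\limsup_{n\to\infty}[\lambda_{\max}(\mathbf{V}_n)]^{-1/2-\delta}\sup_{\boldsymbol{\beta}\in B_r}|||\mathcal{D}_n(\boldsymbol{\beta})-\mathcal{D}_n|||=0$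 a.s.; (iii) a.s., $[\lambda_{\max}(\mathbf{V}_n)]^{-1/2-\delta}|\lambda^T\mathcal{D}_n\lambda|\ge c_0$ for all $\lambda\in\mathbb{R}^p$ with $\|\lambda\|=1$ and all $n\ge n_1$. Then there exist a sequence of random variables $\{\hat{\boldsymbol{\beta}}_n\}_n$ with values in $\mathcal{T}$ and a random number $n_0$ such that (a) $P(\mathbf{q}_n(\hat{\boldsymbol{\beta}}_n)=0\text{ for all }n\ge n_0)=1$; (b) $\hat{\boldsymbol{\beta}}_n\to\boldsymbol{\beta}_0$ a.s.
   Context: $\mathcal{T}\subset\mathbb{R}^p$ is the parameter set and $\boldsymbol{\beta}_0\in\mathcal{T}$ the true parameter. One works on a single probability space $(\Omega,\mathcal{F},P)$ with $P=P_{\boldsymbol{\beta}_0}$ (expectation $\mathrm{E}$), equipped with an increasing sequence of $P$-complete sigma-fields $(\mathcal{F}_i)_{i\ge0}$. $B_r=\{\boldsymbol{\beta}:\|\boldsymbol{\beta}-\boldsymbol{\beta}_0\|\le r\}$ for $r>0$; conditions over $\boldsymbol{\beta}\in B_r$ presuppose that the functions are defined there, i.e. $B_r\subset\mathcal{T}$. For a $p\times p$ matrix $\mathbf{A}$, $|||\mathbf{A}|||=\sup_{\|\mathbf{x}\|=1}|\mathbf{x}^T\mathbf{A}\mathbf{x}|$ is the numerical radius. $\lambda_{\min},\lambda_{\max}$ denote the smallest and largest eigenvalues. *)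

(* Defs.v *)
From HB Require Import structures.
From mathcomp Require Import all_boot all_order all_algebra.
From mathcomp Require Import all_classical all_reals all_analysis.
Set Implicit Arguments.
Unset Strict Implicit.
Unset Printing Implicit Defensive.
Import Order.TTheory GRing.Theory Num.Theory.
Import numFieldNormedType.Exports.
Local Open Scope classical_set_scope.
Local Open Scope ring_scope.

(* Vectors of R^p are row vectors 'rV[R]_p: the textbook x^T A x is
   x *m A *m x^T below, and u u^T is u^T *m u. *)

Section linear_algebra.
Context {R : realType} {p : nat}.
Implicit Types (x b : 'rV[R]_p) (A : 'M[R]_p).

(* The library norm `|x| on 'rV[R]_p is the sup norm. *)
Definition enorm x : R := Num.sqrt (\sum_j x 0 j ^+ 2).

Definition eball b (r : R) : set 'rV[R]_p := [set x | enorm (x - b) <= r].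

Definition qform A x : R := (x *m A *m x^T) 0 0.

Definition posdefmx A : Prop := A^T = A /\ forall x, x != 0 -> 0 < qform A x.

Definition numerical_radius A : R :=
  sup [set `|qform A x| | x in [set x | enorm x = 1]].

(* The set of eigenvalues is finite, so that sup and inf are a maximum and a
   minimum whenever it is nonempty, e.g. for A symmetric and 0 < p. *)
Definition lambda_max A : R := sup [set a | eigenvalue A a].
Definition lambda_min A : R := inf [set a | eigenvalue A a].

End linear_algebra.

Section conditional_expectation.
Context {d : measure_display} {T : measurableType d} {R : realType}.
Variable P : probability T R.
Implicit Types (G : set (set T)) (F : nat -> set (set T)).

(* P-completeness is the last clause: every F i contains all the subsets of
   the P-null sets of the ambient sigma-field. *)
Definition complete_filtration F : Prop :=
  [/\ forall i, sigma_algebra setT (F i),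
      forall i, F i `<=` measurable,
      forall i j, (i <= j)%N -> F i `<=` F j
    & forall i, P.-negligible `<=` F i].

Definition sub_measurable G (X : T -> R) : Prop :=
  forall B : set R, measurable B -> G (X @^-1` B).

(* Y is a version of E(X | G). *)
Definition is_condexp G (X Y : T -> R) : Prop :=
  [/\ P.-integrable setT (EFin \o X),
      P.-integrable setT (EFin \o Y),
      sub_measurable G Y
    & forall A, G A ->
        (\int[P]_(w in A) (Y w)%:E = \int[P]_(w in A) (X w)%:E)%E].

(* The time index of the martingale runs over n >= 1. *)
Definition is_martingale1 F (X : nat -> T -> R) : Prop :=
  [/\ forall n, (1 <= n)%N -> sub_measurable (F n) (X n),
      forall n, (1 <= n)%N -> P.-integrable setT (EFin \o X n)
    & forall m n, (1 <= m <= n)%N -> is_condexp (F m) (X n) (X m)].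

(* 'rV[R]_p carries no sigma-field in the library; Borel measurability of a
   vector-valued map amounts to that of its coordinates. *)
Definition random_vector {p} (X : T -> 'rV[R]_p) : Prop :=
  forall j, measurable_fun setT (fun w => X w 0 j).

Definition sq_integrable_martingale1 {p} F (X : nat -> T -> 'rV[R]_p) : Prop :=
  forall j, is_martingale1 F (fun n w => X n w 0 j) /\
    forall n, (1 <= n)%N -> (fun w => X n w 0 j) \in Lfun P 2%:E.

Definition centered1 {p} (X : nat -> T -> 'rV[R]_p) : Prop :=
  forall n j, (1 <= n)%N -> ('E_P[fun w => X n w 0%R j] = 0)%E.

End conditional_expectation.

Section estimating_functions.
Context {T : Type} {R : realType} {p : nat}.
Implicit Types (u : nat -> 'rV[R]_p -> T -> 'rV[R]_p) (W : nat -> T -> 'M[R]_p).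

Definition est_fun u (n : nat) (b : 'rV[R]_p) (w : T) : 'rV[R]_p :=
  \sum_(1 <= i < n.+1) u i b w.

(* 'J f b acts on row vectors from the right (v |-> v *m 'J f b); its transpose
   is therefore the matrix of entries d f_i / d b_j, i.e. df/db^T. *)
Definition est_deriv u (n : nat) (b : 'rV[R]_p) (w : T) : 'M[R]_p :=
  - ('J (fun b' => est_fun u n b' w) b)^T.

Definition C1_on (D : set 'rV[R]_p) (f : 'rV[R]_p -> 'rV[R]_p) : Prop :=
  (forall b, D b -> differentiable f b) /\
  {within D, continuous (fun b => 'J f b)}.

Definition cond_var W (n : nat) (w : T) : 'M[R]_p :=
  \sum_(1 <= i < n.+1) W i w.

End estimating_functions.

(* Main.v *)
Require Import Defs.
From HB Require Import structures.
From mathcomp Require Import all_boot all_order all_algebra.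
From mathcomp Require Import all_classical all_reals all_analysis.
From mathcomp Require Import measurable_realfun ring lra.
Set Implicit Arguments.
Unset Strict Implicit.
Unset Printing Implicit Defensive.
Import Order.TTheory GRing.Theory Num.Theory.
Import numFieldNormedType.Exports.
Local Open Scope classical_set_scope.
Local Open Scope ring_scope.

(* Coordinatewise, S_n = (1 + V_n)^(-1-a) M_n^2 + (1 + V_n)^(-a) / a is a nonnegative
   supermartingale when V is the conditional variance of the martingale M, by convexity
   of the power function; the maximal inequality bounds it a.s., hence
   q_n(beta0) = o(lambda_max(V_n)^(1/2+delta)) for any delta > 0.
   Conditions (ii) and (iii) bound the quadratic form of D_n(beta) from below by a
   multiple of lambda_max(V_n)^(1/2+delta) on a small ball, so by the mean value theorem
   |q_n| exceeds |q_n(beta0)| on its boundary and the minimiser of |q_n| over the ball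
   is interior; being critical for |q_n|^2, it is a root.  By (i) the root in B_{r_1} is
   unique, so it is the limit of the first points of a fixed dense sequence at which
   |q_n| < 1/m; that limit depends measurably on the sample point. *)

Section euclidean.
Context {R : realType} {p : nat}.
Implicit Types (x y z b : 'rV[R]_p) (A B : 'M[R]_p) (a r t : R).

Definition dot x y : R := (x *m y^T) 0 0.

Lemma dotE x y : dot x y = \sum_j x 0 j * y 0 j.
Proof. by rewrite /dot mxE; apply: eq_bigr => j _; rewrite mxE. Qed.

Lemma dotC x y : dot x y = dot y x.
Proof. by rewrite !dotE; apply: eq_bigr => j _; rewrite mulrC. Qed.

Lemma dotDl x y z : dot (x + y) z = dot x z + dot y z.
Proof. by rewrite /dot mulmxDl mxE. Qed.

Lemma dotZl a x y : dot (a *: x) y = a * dot x y.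
Proof. by rewrite /dot -scalemxAl mxE. Qed.

Lemma dotBl x y z : dot (x - y) z = dot x z - dot y z.
Proof. by rewrite -scaleN1r dotDl dotZl mulN1r. Qed.

Lemma dotDr x y z : dot z (x + y) = dot z x + dot z y.
Proof. by rewrite ![dot z _]dotC dotDl. Qed.

Lemma dotBr x y z : dot z (x - y) = dot z x - dot z y.
Proof. by rewrite ![dot z _]dotC dotBl. Qed.

Lemma dotZr a x y : dot y (a *: x) = a * dot y x.
Proof. by rewrite ![dot y _]dotC dotZl. Qed.

Lemma enorm_ge0 x : 0 <= enorm x.
Proof. exact: sqrtr_ge0. Qed.

Lemma enorm_sqr x : enorm x ^+ 2 = dot x x.
Proof.
rewrite /enorm sqr_sqrtr; last by apply: sumr_ge0 => j _; exact: sqr_ge0.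
by rewrite dotE; apply: eq_bigr.
Qed.

Lemma enormE x : enorm x = Num.sqrt (dot x x).
Proof. by rewrite -enorm_sqr sqrtr_sqr ger0_norm// enorm_ge0. Qed.

Lemma enorm0 : enorm (0 : 'rV[R]_p) = 0.
Proof. by rewrite enormE /dot mul0mx mxE sqrtr0. Qed.

Lemma enormZ a x : enorm (a *: x) = `|a| * enorm x.
Proof.
rewrite !enormE dotZl dotZr mulrA sqrtrM ?sqrtr_sqr//.
by rewrite -expr2 sqr_ge0.
Qed.

Lemma enormN x : enorm (- x) = enorm x.
Proof. by rewrite -scaleN1r enormZ normrN1 mul1r. Qed.

Lemma ler_coord_enorm x j : `|x 0 j| <= enorm x.
Proof.
rewrite -sqrtr_sqr ler_sqrt; last by apply: sumr_ge0 => k _; exact: sqr_ge0.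
by rewrite (bigD1 j)//= lerDl; apply: sumr_ge0 => k _; exact: sqr_ge0.
Qed.

Lemma enorm_eq0 x : (enorm x == 0) = (x == 0).
Proof.
apply/eqP/eqP => [x0|->]; last exact: enorm0.
apply/rowP => j; apply/eqP; rewrite mxE -normr_le0.
by rewrite (le_trans (ler_coord_enorm x j))// x0.
Qed.

Lemma enorm_gt0 x : (0 < enorm x) = (x != 0).
Proof. by rewrite lt_def enorm_ge0 enorm_eq0 andbT. Qed.

Lemma ler_dot x y : `|dot x y| <= enorm x * enorm y.
Proof.
have [->|x0] := eqVneq x 0.
  by rewrite /dot mul0mx mxE normr0 mulr_ge0// enorm_ge0.
rewrite -ler_sqr ?nnegrE ?mulr_ge0 ?enorm_ge0// real_normK ?num_real//.
rewrite exprMn !enorm_sqr.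
have xx : 0 < dot x x by rewrite -enorm_sqr exprn_gt0// enorm_gt0.
have : 0 <= dot (dot x x *: y - dot x y *: x) (dot x x *: y - dot x y *: x).
  by rewrite -enorm_sqr sqr_ge0.
rewrite !(dotBl, dotBr, dotZl, dotZr) [dot y x]dotC => h.
have : 0 <= dot x x * (dot x x * dot y y - dot x y ^+ 2) by lra.
by rewrite pmulr_rge0// subr_ge0.
Qed.

Lemma ler_enormD x y : enorm (x + y) <= enorm x + enorm y.
Proof.
rewrite -ler_sqr ?nnegrE ?addr_ge0 ?enorm_ge0//.
rewrite sqrrD !enorm_sqr dotDl !dotDr [dot y x]dotC.
have /ler_normlW := ler_dot x y.
lra.
Qed.

End euclidean.

Section euclidean_topology.
Context {R : realType} {p : nat}.
Implicit Types (x y z b : 'rV[R]_p) (A B : 'M[R]_p) (a r t : R).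

Lemma continuous_dot_coord (T : topologicalType) (f g : T -> 'rV[R]_p) (w : T) :
  (forall j, f v 0 j @[v --> w] --> f w 0 j) ->
  (forall j, g v 0 j @[v --> w] --> g w 0 j) ->
  dot (f v) (g v) @[v --> w] --> dot (f w) (g w).
Proof.
move=> cf cg; rewrite dotE; under eq_fun do rewrite dotE.
by apply: cvg_big => [|j _]; [exact: add_continuous|exact: cvgM].
Qed.

Lemma continuous_dot (T : topologicalType) (f g : T -> 'rV[R]_p) (w : T) :
  f v @[v --> w] --> f w -> g v @[v --> w] --> g w ->
  dot (f v) (g v) @[v --> w] --> dot (f w) (g w).
Proof.
move=> cf cg; apply: continuous_dot_coord => j.
- exact: (cvg_comp _ (fun x : 'rV[R]_p => x 0 j) cf (@coord_continuous _ _ _ _ _ _)).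
- exact: (cvg_comp _ (fun x : 'rV[R]_p => x 0 j) cg (@coord_continuous _ _ _ _ _ _)).
Qed.

Lemma continuous_enorm : continuous (@enorm R p).
Proof.
move=> x; rewrite (_ : @enorm R p = fun x => Num.sqrt (dot x x)); last first.
  by apply/funext => y; rewrite enormE.
apply: (@cvg_comp _ _ _ (fun x => dot x x) Num.sqrt); last exact: sqrt_continuous.
by apply: (@continuous_dot _ id id); exact: cvg_id.
Qed.

Lemma continuous_enormB b : continuous (fun x => enorm (x - b)).
Proof.
move=> x; apply: (@continuous_comp _ _ _ (fun x => x - b)).
  exact: (@cvgB R 'rV[R]_p _ (nbhs x) _ id (fun=> b) x b cvg_id (cvg_cst _)).
exact: continuous_enorm.
Qed.

Lemma norm_le_enorm x : `|x| <= enorm x.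
Proof.
rewrite [leLHS]/Num.Def.normr/= mx_normrE; apply/bigmax_leP; split => [|[i j] _] /=.
  exact: enorm_ge0.
by rewrite ord1 ler_coord_enorm.
Qed.

Lemma compact_eball b r : compact (eball b r).
Proof.
apply: bounded_closed_compact.
  exists (r + enorm b); split; first exact: num_real.
  move=> M rM x; rewrite /eball/= => xr.
  apply: (le_trans (norm_le_enorm x)); apply: ltW; apply: le_lt_trans rM.
  rewrite -[x](subrK b) (le_trans (ler_enormD _ _))// lerD2r.
  exact: xr.
apply: (@preimage_closed _ _ (fun x => enorm (x - b)) [set t | t <= r]).
  by move=> x _; exact: continuous_enormB.
exact: closed_le.
Qed.

Lemma compact_esphere : compact [set x : 'rV[R]_p | enorm x = 1].
Proof.
apply: (subclosed_compact _ (@compact_eball 0 1)).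
  apply: (@preimage_closed _ _ (@enorm R p) [set t | t = 1]); last exact: closed_eq.
  by move=> x _; exact: continuous_enorm.
by move=> x /= x1; rewrite /eball/= subr0 x1.
Qed.

Lemma qformE A x : qform A x = dot (x *m A) x.
Proof. by []. Qed.

Lemma qformZ A a x : qform A (a *: x) = a ^+ 2 * qform A x.
Proof. by rewrite !qformE -scalemxAl dotZl dotZr mulrA expr2. Qed.

Lemma qformB A B x : qform (A - B) x = qform A x - qform B x.
Proof. by rewrite !qformE mulmxBr dotBl. Qed.

Lemma qformNtr A x : qform (- A^T) x = - qform A x.
Proof.
rewrite /qform mulmxN mulNmx mxE; congr (- _).
have -> : x *m A^T *m x^T = (x *m A *m x^T)^T by rewrite !trmx_mul trmxK mulmxA.
by rewrite mxE.
Qed.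

Lemma continuous_qform A : continuous (qform A).
Proof.
move=> x; apply: (@continuous_dot_coord _ (fun x => x *m A) id) => j; last first.
  exact: coord_continuous.
rewrite mxE; under eq_fun do rewrite mxE.
apply: (@cvg_big _ _ +%R 0 xpredT add_continuous _ (nbhs x)) => i _.
by apply: (@cvgM _ _ (nbhs x)); [exact: coord_continuous|exact: cvg_cst].
Qed.

End euclidean_topology.

Section line_calculus.
Context {R : realType} {p : nat}.
Implicit Types (f : 'rV[R]_p -> 'rV[R]_p) (a v b : 'rV[R]_p) (m r t : R).

Lemma is_derive_coord_line f a v t j : differentiable f (a + t *: v) ->
  is_derive t (1 : R) (fun s => f (a + s *: v) 0 j)
    ((v *m 'J f (a + t *: v)) 0 j).
Proof.
move=> df; rewrite -deriveEjacobian//.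
have dv : (fun h => h^-1 *: ((f \o shift (a + t *: v)) (h *: v) - f (a + t *: v)))
    @ 0^' --> 'D_v f (a + t *: v) by exact: (diff_derivable df).
have c : (fun h => h^-1 *: (((fun s => f (a + s *: v) 0 j) \o shift t) (h *: 1) -
    f (a + t *: v) 0 j)) @ 0^' --> ('D_v f (a + t *: v)) 0 j.
  have := cvg_comp _ (fun x : 'rV[R]_p => x 0 j) dv (@coord_continuous _ _ _ _ _ _).
  apply: cvg_trans; apply: near_eq_cvg; apply: nearW => h /=.
  rewrite !mxE; congr (_ * (f _ 0 j - _)).
  by rewrite scalerDl [h *: 1]mulr1 addrCA addrC.
exact: (DeriveDef (cvgP _ c) (cvg_lim _ c)).
Qed.

Lemma segment_MVT f a v :
  (forall t, 0 <= t <= 1 -> differentiable f (a + t *: v)) ->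
  exists2 t, 0 <= t <= 1 &
    dot (f (a + v) - f a) v = qform ('J f (a + t *: v)) v.
Proof.
move=> df.
pose h s := dot (f (a + s *: v)) v.
have hE : h = \sum_j (fun s => f (a + s *: v) 0 j * v 0 j).
  by apply/funext => s; rewrite /h dotE fct_sumE.
have dh (s : R) : 0 <= s <= 1 -> is_derive s (1 : R) h (qform ('J f (a + s *: v)) v).
  move=> s01; rewrite hE qformE dotE.
  apply: is_derive_sum => j; have dj := is_derive_coord_line j (df _ s01).
  have := is_deriveM dj (is_derive_cst (v 0 j) s (1 : R)).
  by move/is_derive_eq; apply; rewrite scaler0 add0r [LHS]mulrC.
have [t t01 ht] : exists2 t, t \in `[0%R, 1%R] &
    h 1 - h 0 = qform ('J f (a + t *: v)) v * (1 - 0).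
  apply: MVT_segment => //.
    by move=> x; rewrite in_itv/= => /andP[x0 x1]; apply: dh; rewrite !ltW.
  apply: derivable_within_continuous => x; rewrite in_itv/= => x01.
  by have [] := dh _ x01.
exists t; first by rewrite in_itv/= in t01.
by move: ht; rewrite /h scale1r scale0r addr0 subr0 mulr1 dotBl.
Qed.

Lemma eball_segment b r x v t : eball b r x -> eball b r (x + v) ->
  0 <= t <= 1 -> eball b r (x + t *: v).
Proof.
rewrite /eball/= => xr vr /andP[t0 t1].
have -> : x + t *: v - b = (1 - t) *: (x - b) + t *: (x + v - b).
  by apply/rowP => j; rewrite !mxE; ring.
apply: (le_trans (ler_enormD _ _)); rewrite !enormZ !ger0_norm ?subr_ge0//.
have -> : r = (1 - t) * r + t * r by ring.
by rewrite lerD// ler_wpM2l// subr_ge0.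
Qed.

Lemma root_unique f b r :
  (forall x, eball b r x -> differentiable f x) ->
  (forall x v, eball b r x -> enorm v = 1 -> qform ('J f x) v != 0) ->
  forall x y, eball b r x -> eball b r y -> f x = 0 -> f y = 0 -> x = y.
Proof.
move=> df nz x y xr yr fx fy; apply/eqP; rewrite eq_sym -subr_eq0.
apply/negP => /negP v0.
have yE : x + (y - x) = y by rewrite addrC subrK.
have [|t t01] := @segment_MVT f x (y - x).
  by move=> t t01; apply: df; apply: eball_segment => //; rewrite yE.
rewrite yE fx fy subrr /dot mul0mx mxE => /esym.
have nv : enorm (y - x) != 0 by rewrite enorm_eq0.
have /nz-/(_ ((enorm (y - x))^-1 *: (y - x))) : eball b r (x + t *: (y - x)).
  by apply: eball_segment => //; rewrite yE.
rewrite qformZ enormZ ger0_norm ?invr_ge0 ?enorm_ge0// mulVf// => /(_ erefl).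
by move=> + q0; rewrite q0 mulr0 eqxx.
Qed.

(* No fixed point theorem is needed: a minimiser of |f|^2 over the ball is not on
   the boundary, where |f| > |f b|, so it is a critical point, and there f * J = 0. *)
Lemma root_exists f b r m : 0 < r ->
  (forall x, eball b r x -> differentiable f x) ->
  (forall x v, eball b r x -> enorm v = 1 -> m <= `|qform ('J f x) v|) ->
  enorm (f b) < m * r / 2 -> exists2 x, eball b r x & f x = 0.
Proof.
move=> r0 df lbm fb.
have m0 : 0 < m.
  by have : 0 < m * r / 2 := le_lt_trans (enorm_ge0 _) fb; rewrite !pmulr_lgt0.
have bb : eball b r b by rewrite /eball/= subrr enorm0 ltW.
have lb x v : eball b r x -> m * enorm v ^+ 2 <= `|qform ('J f x) v|.
  move=> xr; have [->|v0] := eqVneq v 0; first by rewrite enorm0 expr0n mulr0.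
  have nv : enorm v != 0 by rewrite enorm_eq0.
  have := lbm x ((enorm v)^-1 *: v) xr.
  rewrite qformZ enormZ ger0_norm ?invr_ge0 ?enorm_ge0// mulVf// => /(_ erefl).
  rewrite normrM ger0_norm ?sqr_ge0// exprVn mulrC ler_pdivlMr//.
  by rewrite exprn_gt0// enorm_gt0.
have [x xr xmin] : exists2 x, x \in eball b r &
    forall y, y \in eball b r -> dot (f x) (f x) <= dot (f y) (f y).
  apply: (@EVT_min_rV _ _ (fun x => dot (f x) (f x))).
  - by exists b.
  - exact: compact_eball.
  rewrite continuous_subspace_in => x; rewrite inE => xr.
  apply: continuous_subspaceT_for => //.
  by apply: continuous_dot; exact/differentiable_continuous/df.
rewrite inE in xr; exists x => //.
have {}xmin y : eball b r y -> enorm (f x) <= enorm (f y).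
  by move=> yr; rewrite !enormE ler_sqrt ?xmin ?inE// -enorm_sqr sqr_ge0.
have xlt : enorm (x - b) < r.
  rewrite lt_neqAle xr andbT; apply/negP => /eqP xE.
  have xbE : b + (x - b) = x by rewrite addrC subrK.
  have [|t t01] := @segment_MVT f b (x - b).
    by move=> t t01; apply: df; apply: eball_segment => //; rewrite xbE.
  move=> tE; have : m * r ^+ 2 <= `|dot (f (b + (x - b)) - f b) (x - b)|.
    by rewrite tE -xE; apply: lb; apply: eball_segment => //; rewrite xbE.
  rewrite xbE => /le_trans/(_ (ler_dot _ _)); rewrite xE expr2 mulrA ler_pM2r//.
  move/le_trans/(_ (ler_enormD _ _)); rewrite enormN => mr.
  have := xmin b bb; lra.
apply/eqP; rewrite -enorm_eq0 -sqrf_eq0.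
pose v := f x.
have x0 : x + (0 : R) *: v = x by rewrite scale0r addr0.
pose e := (r - enorm (x - b)) / (1 + enorm v).
have e0 : 0 < e by rewrite divr_gt0 ?subr_gt0// ltr_wpDr ?enorm_ge0.
have inb (t : R) : t \in `]- e, e[ -> eball b r (x + t *: v).
  rewrite in_itv/= -ltr_norml => te; rewrite /eball/= addrAC.
  apply: (le_trans (ler_enormD _ _)); rewrite enormZ.
  have : `|t| * (1 + enorm v) < r - enorm (x - b).
    by rewrite -ltr_pdivlMr// ltr_wpDr ?enorm_ge0.
  have := normr_ge0 t; lra.
pose h s := dot (f (x + s *: v)) (f (x + s *: v)).
have hE : h = \sum_j (fun s => f (x + s *: v) 0 j * f (x + s *: v) 0 j).
  by apply/funext => s; rewrite /h dotE fct_sumE.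
have dh (s : R) : s \in `]- e, e[ -> is_derive s (1 : R) h
    (2 * dot (v *m 'J f (x + s *: v)) (f (x + s *: v))).
  move=> se; rewrite hE dotE mulr_sumr.
  apply: is_derive_sum => j; have dj := is_derive_coord_line j (df _ (inb _ se)).
  have := is_deriveM dj dj.
  by move/is_derive_eq; apply; rewrite /GRing.scale/=; ring.
have e00 : (0 : R) \in `]- e, e[ by rewrite in_itv/= oppr_lt0 e0.
have : is_derive (0 : R) (1 : R) h 0.
  apply: (@derive1_at_min _ _ (- e) e) => //.
  - by rewrite ge0_cp// ltW.
  - by move=> t te; have [] := dh t te.
  - move=> t te; rewrite /h x0 -!enorm_sqr ler_sqr ?nnegrE ?enorm_ge0//.
    exact/xmin/inb.
move=> /@derive_val; have /@derive_val -> := dh 0 e00.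
rewrite x0 -/v => /eqP; rewrite mulf_eq0 pnatr_eq0/= => /eqP q0.
have := lb x v xr; rewrite qformE q0 normr0 pmulr_rle0// => v0.
by apply/eqP/le_anti; rewrite v0 sqr_ge0.
Qed.

End line_calculus.

Section spectral_bounds.
Context {R : realType} {p : nat}.
Implicit Types (x v : 'rV[R]_p) (A : 'M[R]_p).

Lemma ler_qform_numerical_radius A x : enorm x = 1 ->
  `|qform A x| <= numerical_radius A.
Proof.
move=> x1; apply: ub_le_sup; last by exists x.
have [||c _ cmax] := @EVT_max_rV R p (fun x => `|qform A x|) _ _ (@compact_esphere R p).
- by exists x.
- apply: continuous_subspaceT => y; apply: continuous_comp.
    exact: continuous_qform.
  exact: norm_continuous.
- by exists `|qform A c| => _ [y y1 <-]; apply: cmax; rewrite inE.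
Qed.

Lemma qform_eigen A a v : v *m A = a *: v -> qform A v = a * enorm v ^+ 2.
Proof. by move=> vA; rewrite qformE vA dotZl enorm_sqr. Qed.

Lemma enorm_delta j : enorm (delta_mx 0 j : 'rV[R]_p) = 1.
Proof.
rewrite enormE dotE (bigD1 j)//= big1 => [|k kj].
  by rewrite !mxE/= eqxx mulr1 addr0 sqrtr1.
by rewrite !mxE/= (negbTE kj) mulr0.
Qed.

Lemma qform_delta A j : qform A (delta_mx 0 j) = A j j.
Proof.
rewrite qformE -rowE dotE (bigD1 j)//= big1 => [|k kj].
  by rewrite !mxE/= eqxx mulr1 addr0.
by rewrite !mxE/= (negbTE kj) mulr0.
Qed.

Lemma dot_mulmx A x v : A^T = A -> dot (v *m A) x = dot (x *m A) v.
Proof. by move=> At; rewrite [RHS]dotC /dot trmx_mul At mulmxA. Qed.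

(* The maximum mu of the form over the unit sphere is an eigenvalue: mu |x|^2 - x A x^T
   is nonnegative and vanishes at the maximiser, so its derivative vanishes there. *)
Lemma sym_max_eigenvalue A : (0 < p)%N -> A^T = A ->
  exists2 mu, eigenvalue A mu & forall x, qform A x <= mu * enorm x ^+ 2.
Proof.
move=> p0 At.
have [||x0 x01 xmax] := @EVT_max_rV R p (qform A) _ _ (@compact_esphere R p).
- by exists (delta_mx 0 (Ordinal p0)); exact: enorm_delta.
- by apply: continuous_subspaceT; exact: continuous_qform.
rewrite inE/= in x01; pose mu := qform A x0.
have ub x : qform A x <= mu * enorm x ^+ 2.
  have [->|xn0] := eqVneq x 0.
    by rewrite qformE /dot !mul0mx mxE enorm0 expr0n mulr0.
  have nx : enorm x != 0 by rewrite enorm_eq0.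
  have := xmax ((enorm x)^-1 *: x).
  rewrite inE/= enormZ ger0_norm ?invr_ge0 ?enorm_ge0// mulVf// => /(_ erefl).
  by rewrite qformZ exprVn mulrC ler_pdivrMr// exprn_gt0// enorm_gt0.
exists mu => //; apply/eigenvalueP; exists x0; last by rewrite -enorm_eq0 x01 oner_neq0.
have [y yE] : exists y, y = mu *: x0 - x0 *m A by exists (mu *: x0 - x0 *m A).
pose Q x := mu * dot x x - dot (x *m A) x.
have Qge0 x : 0 <= Q x by rewrite subr_ge0 -enorm_sqr; exact: ub.
have Q0 : Q x0 = 0 by rewrite /Q -enorm_sqr x01 expr1n mulr1 subrr.
have Qt t : Q (x0 + t *: y) = 2 * t * dot y y + t ^+ 2 * Q y.
  have -> : dot y y = mu * dot x0 y - dot (x0 *m A) y by rewrite {1}yE dotBl dotZl.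
  move: Q0; rewrite /Q mulmxDl -scalemxAl !(dotDl, dotDr, dotZl, dotZr).
  rewrite [dot y x0]dotC [dot (y *m A) x0]dot_mulmx//.
  by move=> /eqP; rewrite subr_eq0 => /eqP E; ring: E.
suff : dot y y = 0.
  by move/eqP; rewrite -enorm_sqr sqrf_eq0 enorm_eq0 yE subr_eq0 => /eqP.
have d0 : 0 <= dot y y by rewrite -enorm_sqr sqr_ge0.
pose s := dot y y / (Q y + 1).
have Qy := Qge0 y.
have sE : s * (Q y + 1) = dot y y by rewrite /s divfK// gt_eqF// ltr_wpDl.
have s0 : 0 <= s by rewrite divr_ge0// addr_ge0.
have := Qge0 (x0 + (- s) *: y); rewrite Qt -{1}sE => h.
have {}h : 0 <= s ^+ 2 * (- Q y - 2).
  by apply: le_trans h _; rewrite le_eqVlt; apply/orP; left; apply/eqP; ring.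
have [s00|sn0] := eqVneq s 0; first by rewrite -sE s00 mul0r.
by move: h; rewrite pmulr_rge0 ?exprn_even_gt0//; lra.
Qed.

Lemma eigenvalue_qform_le A mu a : (forall x, qform A x <= mu * enorm x ^+ 2) ->
  eigenvalue A a -> a <= mu.
Proof.
move=> ub /eigenvalueP[v vA v0]; have := ub v; rewrite (qform_eigen vA).
by rewrite ler_pM2r// exprn_gt0// enorm_gt0.
Qed.

Lemma qform_le_lambda_max A x : (0 < p)%N -> A^T = A ->
  qform A x <= lambda_max A * enorm x ^+ 2.
Proof.
move=> p0 At; have [mu emu ub] := sym_max_eigenvalue p0 At.
apply: (le_trans (ub x)); rewrite ler_wpM2r ?sqr_ge0//.
by apply: ub_le_sup => //; exists mu => a; exact: eigenvalue_qform_le.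
Qed.

Lemma diag_le_lambda_max A j : A^T = A -> A j j <= lambda_max A.
Proof.
move=> At; have p0 : (0 < p)%N := leq_ltn_trans (leq0n j) (ltn_ord j).
have := @qform_le_lambda_max A (delta_mx 0 j) p0 At.
by rewrite qform_delta enorm_delta expr1n mulr1.
Qed.

Lemma lambda_min_le_max A : (0 < p)%N -> posdefmx A -> lambda_min A <= lambda_max A.
Proof.
move=> p0 [At pd]; have [mu emu ub] := sym_max_eigenvalue p0 At.
apply: (@le_trans _ _ mu); last first.
  by apply: ub_le_sup => //; exists mu => a; exact: eigenvalue_qform_le.
apply: ge_inf => //; exists 0 => a /eigenvalueP[v vA v0].
have := pd v v0; rewrite (qform_eigen vA) => /ltW.
by rewrite pmulr_lge0// exprn_gt0// enorm_gt0.
Qed.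

Lemma lambda_max_gt0 A : (0 < p)%N -> posdefmx A -> 0 < lambda_max A.
Proof.
move=> p0 [At pd]; have e1 := @enorm_delta (Ordinal p0).
apply: (@lt_le_trans _ _ (A (Ordinal p0) (Ordinal p0))); last exact: diag_le_lambda_max.
by rewrite -qform_delta; apply: pd; rewrite -enorm_eq0 e1 oner_neq0.
Qed.

End spectral_bounds.

Section asymptotic_roots.
Context {R : realType} {p : nat}.

Lemma eventually_root (q : nat -> 'rV[R]_p -> 'rV[R]_p) (a : nat -> R)
    (D : nat -> 'rV[R]_p -> 'M[R]_p) (b0 : 'rV[R]_p) (c0 r1 : R) (n1 : nat) :
  (forall n b v, `|qform (D n b) v| = `|qform ('J (q n) b) v|) ->
  0 < r1 -> 0 < c0 -> (forall n, (n1 <= n)%N -> 0 < a n) ->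
  (forall n x, (n1 <= n)%N -> eball b0 r1 x -> differentiable (q n) x) ->
  (limn_esup (fun n => (a n)%:E * ereal_sup
     [set (numerical_radius (D n b - D n b0))%:E | b in eball b0 r])%E
     @[r --> 0^'+] --> 0%E) ->
  (forall v n, enorm v = 1 -> (n1 <= n)%N -> c0 <= a n * `|qform (D n b0) v|) ->
  a n * enorm (q n b0) @[n --> \oo] --> 0 ->
  forall r : R, 0 < r -> \forall n \near \oo, exists x,
    [/\ enorm (x - b0) < r1, enorm (x - b0) < r & q n x = 0].
Proof.
move=> DE r10 c00 a0 dq Sii Siii q0 r r0.
have [r2 [r20 r2r1 r2r Sr2]] : exists r2 : R, [/\ 0 < r2, r2 < r1, r2 < r &
    (limn_esup (fun n => (a n)%:E * ereal_sup
      [set (numerical_radius (D n b - D n b0))%:E | b in eball b0 r2])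
      < (c0 / 2)%:E)%E].
  have n0 : nbhs (0%E : \bar R) [set y | (y < (c0 / 2)%:E)%E].
    apply: open_nbhs_nbhs; split; first exact: open_ereal_lt_ereal.
    by rewrite /= lte_fin divr_gt0.
  have : \forall r2 \near 0^'+, [/\ 0 < r2, r2 < r1, r2 < r &
      (limn_esup (fun n => (a n)%:E * ereal_sup
      [set (numerical_radius (D n b - D n b0))%:E | b in eball b0 r2])
      < (c0 / 2)%:E)%E].
    near=> r2; split.
    - by near: r2; exact: nbhs_right_gt.
    - by near: r2; exact: nbhs_right_lt.
    - by near: r2; exact: nbhs_right_lt.
    by near: r2; exact: (Sii [set y | (y < (c0 / 2)%:E)%E] n0).
  by move/filter_ex.
have [_ [A [N1 _ N1A] <-] Ac] := ereal_inf_lt Sr2.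
have {N1A} up n : (N1 <= n)%N -> ((a n)%:E * ereal_sup
      [set (numerical_radius (D n b - D n b0))%:E | b in eball b0 r2] < (c0 / 2)%:E)%E.
  move=> N1n; apply: le_lt_trans Ac; apply: ereal_sup_ubound.
  by exists n => //; exact: N1A.
have cr : 0 < c0 * r2 / 4 by rewrite divr_gt0 ?mulr_gt0.
near=> n.
have n1n : (n1 <= n)%N by near: n; exact: nbhs_infty_ge.
have N1n : (N1 <= n)%N by near: n; exact: nbhs_infty_ge.
have qn : a n * enorm (q n b0) < c0 * r2 / 4.
  by near: n; apply: (cvgr_lt _ q0).
have an := a0 _ n1n.
have sub x : eball b0 r2 x -> eball b0 r1 x.
  by rewrite /eball/= => /le_trans; apply; exact: ltW.
have [|x v xr v1||x xr qx] := @root_exists R p (q n) b0 r2 (c0 / (2 * a n)) r20.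
- by move=> x /sub; exact: dq.
- have supx : a n * numerical_radius (D n x - D n b0) <= c0 / 2.
    rewrite -lee_fin; apply: le_trans (ltW (up n N1n)); rewrite EFinM.
    by apply: lee_wpmul2l; [rewrite lee_fin ltW|apply: ereal_sup_ubound; exists x].
  have := Siii v n v1 n1n.
  have := ler_qform_numerical_radius (D n x - D n b0) v1.
  rewrite qformB => h1 h2.
  have : `|qform (D n b0) v| <= `|qform (D n x) v| + numerical_radius (D n x - D n b0).
    rewrite -lerBlDl; apply: le_trans _ h1; rewrite distrC.
    exact: lerB_dist.
  rewrite -(ler_pM2l an) mulrDr => h3.
  have := le_trans h2 (le_trans h3 (lerD (lexx _) supx)).
  rewrite -lerBlDr {1}(splitr c0) addrK => h4.
  by rewrite -(DE n) invfM mulrA ler_pdivrMr// [leRHS]mulrC.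
- move: qn; rewrite mulrC -ltr_pdivlMr// => /lt_le_trans; apply.
  suff -> : c0 / (2 * a n) * r2 / 2 = c0 * r2 / 4 / a n by [].
  by field; rewrite gt_eqF// an.
- by exists x; rewrite (le_lt_trans xr)// (le_lt_trans xr).
Unshelve. all: by end_near. Qed.

End asymptotic_roots.

Section real_integrable.
Context {d : measure_display} {T : measurableType d} {R : realType}.
Variable P : probability T R.
Implicit Types f g h : T -> R.

Lemma integrable_EFinD f g : P.-integrable setT (EFin \o f) ->
  P.-integrable setT (EFin \o g) -> P.-integrable setT (EFin \o (fun w => f w + g w)).
Proof. exact: integrableD. Qed.

Lemma integrable_EFinB f g : P.-integrable setT (EFin \o f) ->
  P.-integrable setT (EFin \o g) -> P.-integrable setT (EFin \o (fun w => f w - g w)).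
Proof. exact: integrableB. Qed.

Lemma integrable_EFinZl f (k : R) : P.-integrable setT (EFin \o f) ->
  P.-integrable setT (EFin \o (fun w => k * f w)).
Proof. exact: integrableZl. Qed.

Lemma integrable_EFin_cst (k : R) : P.-integrable setT (EFin \o (fun=> k)).
Proof. exact: finite_measure_integrable_cst. Qed.

Lemma integrable_bounded_mul (h f : T -> R) (M : R) : measurable_fun setT h ->
  (forall w, `|h w| <= M) -> P.-integrable setT (EFin \o f) ->
  P.-integrable setT (EFin \o (fun w => h w * f w)).
Proof.
move=> mh hM iX; have := @integrableMr _ _ _ P setT measurableT h (EFin \o f) mh.
apply => //; exists M; split; first exact: num_real.
by move=> x Mx w _; exact: le_trans (hM w) (ltW Mx).
Qed.

Lemma integrable_bounded (h : T -> R) (M : R) : measurable_fun setT h ->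
  (forall w, `|h w| <= M) -> P.-integrable setT (EFin \o h).
Proof.
move=> mh hM.
have := @integrable_bounded_mul h (fun=> 1) M mh hM (integrable_EFin_cst 1).
by rewrite (_ : (fun w => _) = h)//; apply/funext => w; rewrite mulr1.
Qed.

Lemma Rintegral_indic_mul (A : set T) f :
  \int[P]_w (\1_A w * f w) = \int[P]_(w in A) f w.
Proof.
rewrite [RHS]Rintegral_mkcond; apply: eq_Rintegral => w _.
by rewrite patchE indicE; case: ifP; rewrite ?mul1r ?mul0r.
Qed.

End real_integrable.

Section pull_out.
Context {d : measure_display} {T : measurableType d} {R : realType}.
Variables (P : probability T R) (G : set (set T)).
Hypotheses (sG : sigma_algebra setT G) (Gm : G `<=` measurable).
Local Notation gT := (g_sigma_algebraType G).

Lemma g_measurableE : (measurable : set (set gT)) = G.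
Proof. exact: sigma_algebra_id. Qed.

Lemma sub_measurableP (X : T -> R) :
  sub_measurable G X <-> measurable_fun setT (X : gT -> R).
Proof.
split=> mX; first by move=> _ B mB; rewrite setTI g_measurableE; exact: mX.
by move=> B mB; have := mX measurableT B mB; rewrite setTI g_measurableE.
Qed.

Lemma sub_measurable_fun (X : T -> R) : sub_measurable G X -> measurable_fun setT X.
Proof. by move=> mX _ B mB; rewrite setTI; apply: Gm; exact: mX. Qed.

Lemma indic_bounded (A : set T) (w : T) : `|\1_A w : R| <= 1.
Proof. by rewrite indicE; case: (w \in A); rewrite ?normr1 ?normr0. Qed.

(* h is within 1/n of n^-1 * staircase n (n * h), a combination of indicators of the
   events k <= n * h. *)
Let staircase (n : nat) (y : R) : R := \sum_(k < n) (k.+1%:R <= y)%R%:R.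

Lemma staircase_full n y : n%:R <= y -> staircase n y = n%:R.
Proof.
move=> ny; rewrite /staircase (eq_bigr (fun=> 1)) ?sumr_const ?card_ord// => k _.
by rewrite (le_trans _ ny)// ler_nat.
Qed.

Lemma staircase_dist n y : 0 <= y <= n%:R -> `|y - staircase n y| <= 1.
Proof.
elim: n => [|n IH] /andP[y0 yn].
  by rewrite /staircase big_ord0 subr0 ger0_norm// (le_trans yn).
have [yn1|] := leP n.+1%:R y.
  by rewrite staircase_full// (@le_anti _ _ y n.+1%:R) ?yn ?yn1// subrr normr0.
move=> yn1; rewrite /staircase big_ord_recr/= [_ <= y]leNgt yn1/= addr0.
have [ny|/ltW ny] := leP n%:R y; last by apply: IH; rewrite y0.
rewrite -/(staircase n y) staircase_full// ger0_norm ?subr_ge0//.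
by move: yn1; rewrite -natr1 lerBlDl => /ltW; rewrite addrC.
Qed.

Lemma condexp_mul01 (X Y h : T -> R) : is_condexp P G X Y -> sub_measurable G h ->
  (forall w, 0 <= h w <= 1) ->
  \int[P]_w (h w * Y w) = \int[P]_w (h w * X w).
Proof.
move=> [iX iY mY XY] mh h01.
have mhT := sub_measurable_fun mh.
have hb w : `|h w| <= 1 by case/andP: (h01 w) => ? ?; rewrite ger0_norm.
pose A (n k : nat) := [set w | k.+1%:R <= n%:R * h w].
have GA n k : G (A n k).
  rewrite -g_measurableE -[A n k]setTI.
  apply: (@measurable_fun_le _ gT R setT (cst k.+1%:R) (fun w => n%:R * h w)) => //.
  exact/measurable_funM/sub_measurableP.
have mA n k : measurable (A n k) := Gm (GA n k).
have iA n k Z : P.-integrable setT (EFin \o Z) ->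
    P.-integrable setT (EFin \o (fun w => \1_(A n k) w * Z w)).
  by move=> iZ; apply: (integrable_bounded_mul (M := 1)) => //; exact: indic_bounded.
have stE n w : staircase n (n%:R * h w) = \sum_(k < n) \1_(A n k) w.
  apply: eq_bigr => k _; rewrite indicE; congr ((nat_of_bool _)%:R).
  by apply/idP/idP; rewrite inE.
have isum n m Z : P.-integrable setT (EFin \o Z) ->
    P.-integrable setT (EFin \o (fun w => (\sum_(k < m) \1_(A n k) w) * Z w)) /\
    \int[P]_w ((\sum_(k < m) \1_(A n k) w) * Z w) =
      \sum_(k < m) \int[P]_(w in A n k) Z w.
  move=> iZ; elim: m => [|m [IH1 IH2]].
    rewrite big_ord0 (_ : (fun _ => _) = cst 0); last first.
      by apply/funext => w; rewrite big_ord0 mul0r.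
    by split; [exact: integrable_EFin_cst|rewrite Rintegral_cst// mul0r].
  rewrite (_ : (fun w => _) =
    (fun w => (\sum_(k < m) \1_(A n k) w) * Z w + \1_(A n m) w * Z w)).
    rewrite RintegralD// ?IH2 ?Rintegral_indic_mul ?big_ord_recr//; last exact: iA.
    by split => //; apply: integrable_EFinD => //; exact: iA.
  by apply/funext => w; rewrite big_ord_recr/= mulrDl.
have approx n Z : P.-integrable setT (EFin \o Z) ->
    `|n%:R * \int[P]_w (h w * Z w) - \sum_(k < n) \int[P]_(w in A n k) Z w|
      <= \int[P]_w `|Z w|.
  move=> iZ; have [iS <-] := isum n n Z iZ.
  have ihZ : P.-integrable setT (EFin \o (fun w => n%:R * (h w * Z w))).
    exact/integrable_EFinZl/(integrable_bounded_mul mhT hb iZ).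
  rewrite -RintegralZl//; last exact: (integrable_bounded_mul mhT hb iZ).
  rewrite -RintegralB//.
  have iD : P.-integrable setT (EFin \o (fun w =>
      n%:R * (h w * Z w) - (\sum_(k < n) \1_(A n k) w) * Z w)).
    exact: integrable_EFinB.
  apply: (le_trans (le_normr_Rintegral measurableT iD)).
  apply: le_Rintegral => //; [exact: integrable_norm iD|exact: integrable_norm iZ|].
  move=> w _; rewrite mulrA -mulrBl normrM -[leRHS]mul1r ler_wpM2r//.
  rewrite -stE; apply: staircase_dist; case/andP: (h01 w) => h0 h1.
  by rewrite mulr_ge0//= ler_piMr.
apply/eqP; rewrite eq_sym -subr_eq0 -normr_le0.
apply/ler_addgt0Pr => e e0; rewrite add0r.
set K := \int[P]_w `|X w| + \int[P]_w `|Y w|.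
have K0 : 0 <= K by rewrite addr_ge0// Rintegral_ge0.
have [n nK] : exists n : nat, K / e < n%:R.
  by exists (Num.bound (K / e)); apply: archi_boundP; rewrite divr_ge0// ltW.
have n0 : (0 : R) < n%:R by apply: le_lt_trans nK; rewrite divr_ge0// ltW.
rewrite -(ler_pM2l n0) -[X in X * `|_|]gtr0_norm// -normrM mulrBr.
apply: (@le_trans _ _ K); last by move: nK; rewrite ltr_pdivrMr// => /ltW.
have := approx n X iX; have := approx n Y iY.
have -> : \sum_(k < n) \int[P]_(w in A n k) Y w = \sum_(k < n) \int[P]_(w in A n k) X w.
  by apply: eq_bigr => k _; rewrite /Rintegral XY.
move=> hY hX; rewrite /K.
rewrite -[in leLHS](subrKA (\sum_(k < n) \int[P]_(w in A n k) X w)).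
by apply: (le_trans (ler_normD _ _)); rewrite lerD// distrC.
Qed.

Lemma condexp_mul (X Y h : T -> R) (M : R) : is_condexp P G X Y -> sub_measurable G h ->
  (forall w, `|h w| <= M) ->
  \int[P]_w (h w * Y w) = \int[P]_w (h w * X w).
Proof.
move=> cXY mh hM; have [iX iY mY XY] := cXY.
pose L := `|M| + 1; have L0 : 0 < L by rewrite ltr_wpDl.
pose h' w := (2 * L)^-1 * h w + 2^-1.
have hE w : h w = 2 * L * h' w - L by rewrite /h'; field; rewrite gt_eqF.
have h'01 w : 0 <= h' w <= 1.
  have : `|h w| <= L by rewrite (le_trans (hM w))// (le_trans (ler_norm _))// lerDl.
  rewrite ler_norml => /andP[]; rewrite hE => h1 h2; apply/andP; split.
    by rewrite -(pmulr_rge0 _ L0); lra.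
  by rewrite -(ler_pM2l L0); lra.
have h'b w : `|h' w| <= 1 by case/andP: (h'01 w) => ? ?; rewrite ger0_norm.
have mh' : sub_measurable G h'.
  apply/sub_measurableP; apply: measurable_funD => //.
  exact/measurable_funM/sub_measurableP.
have mh'T := sub_measurable_fun mh'.
have E Z : P.-integrable setT (EFin \o Z) ->
    \int[P]_w (h w * Z w) = 2 * L * \int[P]_w (h' w * Z w) - L * \int[P]_w Z w.
  move=> iZ; have ih' := integrable_bounded_mul mh'T h'b iZ.
  rewrite -!RintegralZl// -RintegralB//.
  - by apply: eq_Rintegral => w _; rewrite hE; ring.
  - exact: integrable_EFinZl.
  - exact: integrable_EFinZl.
rewrite !E// (condexp_mul01 cXY mh' h'01); congr (_ - L * fine _).
by apply: XY; rewrite -g_measurableE; exact: measurableT.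
Qed.

End pull_out.

Section potential.
Context {R : realType}.
Implicit Types a v u : R.

Definition weight a v : R := (1 + v) `^ (- (1 + a)).
Definition potential a v : R := (1 + v) `^ (- a) / a.

Lemma weight_gt0 a v : 0 <= v -> 0 < weight a v.
Proof. by move=> v0; rewrite powR_gt0// ltr_pwDl. Qed.

Lemma weight_le1 a v : 0 < a -> 0 <= v -> weight a v <= 1.
Proof.
move=> a0 v0; rewrite -[leRHS](powRr0 (1 + v)); apply: ler_powR; first by rewrite lerDl.
by rewrite oppr_le0 addr_ge0// ltW.
Qed.

Lemma weight_nincr a u v : 0 < a -> 0 <= u -> u <= v -> weight a v <= weight a u.
Proof.
move=> a0 u0 uv; have v0 := le_trans u0 uv.
rewrite /weight !powRN lef_pV2 ?posrE ?powR_gt0 ?ltr_pwDl//.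
by apply: ge0_ler_powR; rewrite ?nnegrE ?addr_ge0 ?lerD// ltW.
Qed.

Lemma potential_ge0 a v : 0 < a -> 0 <= potential a v.
Proof. by move=> a0; rewrite divr_ge0 ?powR_ge0// ltW. Qed.

Lemma potential_le a v : 0 < a -> 0 <= v -> potential a v <= a^-1.
Proof.
move=> a0 v0; apply: ler_piMl; first by rewrite invr_ge0 ltW.
rewrite -[leRHS](powRr0 (1 + v)).
by apply: ler_powR; [rewrite lerDl|rewrite oppr_le0 ltW].
Qed.

(* Convexity of potential a, whose derivative is - weight a. *)
Lemma weight_le_potential_drop a u v : 0 < a -> 0 <= u -> 0 <= v ->
  weight a v * (v - u) <= potential a u - potential a v.
Proof.
move=> a0 u0 v0.
have s0 : 0 < 1 + u by rewrite ltr_pwDl.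
have t0 : 0 < 1 + v by rewrite ltr_pwDl.
pose y := (1 + u) / (1 + v); have y0 : 0 < y by rewrite divr_gt0.
have sE : 1 + u = (1 + v) * y by rewrite /y mulrC divfK// gt_eqF.
have ya : 1 + a * (1 - y) <= y `^ (- a).
  rewrite /powR gt_eqF//; apply: le_trans (expR_ge1Dx _).
  rewrite lerD2l mulNr -mulrN ler_pM2l// lerNr opprB.
  have /le_ln1Dx : -1 < y - 1 by rewrite ltrBrDl subrr.
  by rewrite addrC subrK.
have wE : weight a v = (1 + v) `^ (- a) / (1 + v).
  by rewrite /weight opprD [- 1 - a]addrC powRD ?(gt_eqF t0) ?implybT// powR_inv1// ltW.
have -> : v - u = (1 + v) * (1 - y) by rewrite mulrBr mulr1 -sE; ring.
rewrite wE mulrA divfK ?gt_eqF// /potential -mulrBl ler_pdivlMr//.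
rewrite sE powRM ?(ltW t0) ?(ltW y0)//.
rewrite -mulrA -[X in _ <= _ - X]mulr1 -mulrBr ler_wpM2l ?powR_ge0//.
by rewrite lerBrDl mulrC.
Qed.

Lemma measurable_weight a : measurable_fun setT (weight a).
Proof.
apply: (measurableT_comp (measurable_powR _)); exact: measurable_funD.
Qed.

Lemma measurable_potential a : measurable_fun setT (potential a).
Proof.
apply: measurable_funM => //.
apply: (measurableT_comp (measurable_powR _)); exact: measurable_funD.
Qed.

End potential.

Section supermartingale_step.
Context {d : measure_display} {T : measurableType d} {R : realType}.
Variables (P : probability T R) (G : set (set T)).
Hypotheses (sG : sigma_algebra setT G) (Gm : G `<=` measurable).
Local Notation gT := (g_sigma_algebraType G).

Definition lyapunov (a m v : R) : R := weight a v * m ^+ 2 + potential a v.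

Lemma lyapunov_ge0 (a m v : R) : 0 < a -> 0 <= v -> 0 <= lyapunov a m v.
Proof.
by move=> a0 v0; rewrite addr_ge0 ?potential_ge0// mulr_ge0 ?sqr_ge0// ltW// weight_gt0.
Qed.

Lemma measurable_lyapunov d' (T' : measurableType d') (a : R) (M V : T' -> R) :
  measurable_fun setT M -> measurable_fun setT V ->
  measurable_fun setT (fun w => lyapunov a (M w) (V w)).
Proof.
move=> mM mV; apply: measurable_funD.
  apply: measurable_funM; last exact: measurable_funX.
  by apply: (measurableT_comp (measurable_weight a)).
by apply: (measurableT_comp (measurable_potential a)).
Qed.

Lemma sub_measurable_indic (D : set T) : G D -> measurable_fun setT (\1_D : gT -> R).
Proof. by move=> GD; apply: measurable_indic; rewrite g_measurableE. Qed.

(* On D the factor M multiplying the increment is bounded by l, so that only bounded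
   random variables have to be pulled out of the conditional expectations. *)
Lemma lyapunov_step (M M' W V : T -> R) (a l : R) (D : set T) : 0 < a ->
  is_condexp P G M' M -> is_condexp P G (fun w => (M' w - M w) ^+ 2) W ->
  sub_measurable G V -> (forall w, 0 <= V w) -> (forall w, 0 <= W w) ->
  G D -> (forall w, D w -> lyapunov a (M w) (V w) < l) ->
  P.-integrable setT (EFin \o (fun w => \1_D w * lyapunov a (M' w) (V w + W w))) /\
  \int[P]_w (\1_D w * lyapunov a (M' w) (V w + W w)) <=
    \int[P]_w (\1_D w * lyapunov a (M w) (V w)).
Proof.
move=> a0 cM cW mV V0 W0 GD Dl.
have [iM' iM mM _] := cM; have [iW' iW mW _] := cW.
have mVg := (sub_measurableP sG V).1 mV; have mMg := (sub_measurableP sG M).1 mM.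
have mWg := (sub_measurableP sG W).1 mW.
have VW0 w : 0 <= V w + W w by rewrite addr_ge0.
have mVWg : measurable_fun setT ((fun w => V w + W w) : gT -> R).
  exact: measurable_funD.
pose h1 w := \1_D w * weight a (V w + W w).
pose h2 w := h1 w * M w.
have mDg := sub_measurable_indic GD.
have mh1g : measurable_fun setT (h1 : gT -> R).
  by apply: measurable_funM => //; apply: (measurableT_comp (measurable_weight a)).
have mh2g : measurable_fun setT (h2 : gT -> R) by exact: measurable_funM.
have mh1 := (sub_measurableP sG h1).2 mh1g; have mh2 := (sub_measurableP sG h2).2 mh2g.
have mh1T := sub_measurable_fun Gm mh1; have mh2T := sub_measurable_fun Gm mh2.
have h1b w : `|h1 w| <= 1.
  by rewrite normrM mulr_ile1// ?indic_bounded// gtr0_norm ?weight_gt0// weight_le1.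
have wt w : weight a (V w + W w) * M w ^+ 2 <= weight a (V w) * M w ^+ 2.
  by rewrite ler_wpM2r ?sqr_ge0// weight_nincr// lerDl.
have h2b w : `|h2 w| <= `|l| + 1.
  rewrite /h2 /h1 indicE; case: (boolP (w \in D)) => wD; last first.
    by rewrite !mul0r normr0 addr_ge0.
  rewrite mul1r; set x := weight _ _ * _.
  have xl : x ^+ 2 <= `|l|.
    rewrite exprMn expr2 -mulrA (le_trans _ (ler_norm l))//.
    apply: (@le_trans _ _ (weight a (V w + W w) * M w ^+ 2)).
      rewrite ler_piMl ?weight_le1// mulr_ge0 ?sqr_ge0// ltW// weight_gt0//.
    apply: (le_trans (wt w)); apply: ltW; rewrite inE in wD.
    apply: le_lt_trans (Dl w wD).
    by rewrite lerDl potential_ge0.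
  have := sqr_ge0 (`|x| - 2^-1); rewrite -(real_normK (num_real x)) in xl; nra.
have ih1W' := integrable_bounded_mul mh1T h1b iW'.
have ih1W := integrable_bounded_mul mh1T h1b iW.
have ih2M' := integrable_bounded_mul mh2T h2b iM'.
have ih2M := integrable_bounded_mul mh2T h2b iM.
have mDT : measurable_fun setT (\1_D : T -> R) by apply: measurable_indic; exact: Gm.
have mpot : measurable_fun setT (fun w => potential a (V w + W w)).
  apply: (measurableT_comp (measurable_potential a)).
  exact/(sub_measurable_fun Gm)/(sub_measurableP sG _).2.
have ipot : P.-integrable setT (EFin \o (fun w => \1_D w * potential a (V w + W w))).
  apply: (integrable_bounded_mul (M := 1)) => //; first exact: indic_bounded.
  apply: (integrable_bounded P (M := a^-1)) => // w.
  by rewrite ger0_norm ?potential_ge0// potential_le.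
pose A w := h1 w * (M' w - M w) ^+ 2 + (2 * (h2 w * M' w) - h2 w * M w).
have AE w : \1_D w * lyapunov a (M' w) (V w + W w) =
    A w + \1_D w * potential a (V w + W w).
  by rewrite /A /lyapunov /h2 /h1; ring.
have i2M' := integrable_EFinZl 2 ih2M'.
have i2 := integrable_EFinB i2M' ih2M.
have iA : P.-integrable setT (EFin \o A) by exact: integrable_EFinD.
rewrite (_ : (fun w => \1_D w * lyapunov a (M' w) (V w + W w)) =
  (fun w => A w + \1_D w * potential a (V w + W w))); last by apply/funext.
split; first exact: integrable_EFinD.
rewrite (RintegralD measurableT iA ipot) (RintegralD measurableT ih1W' i2).
rewrite (RintegralB measurableT i2M' ih2M).
rewrite (RintegralZl 2 measurableT ih2M') -(condexp_mul sG Gm cW mh1 h1b).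
rewrite -(condexp_mul sG Gm cM mh2 h2b).
rewrite (_ : 2 * _ - _ = \int[P]_w (h2 w * M w)); last by ring.
have ih := integrable_EFinD ih1W ih2M.
rewrite -(RintegralD measurableT ih1W ih2M) -(RintegralD measurableT ih ipot).
apply: le_Rintegral => //; first exact: integrable_EFinD.
- have mS : measurable_fun setT (fun w => lyapunov a (M w) (V w)).
    by apply: measurable_lyapunov; exact: (sub_measurable_fun Gm).
  apply: (integrable_bounded P (M := `|l|)); first exact: measurable_funM.
  move=> w; rewrite indicE; case: (boolP (w \in D)) => wD; last by rewrite mul0r normr0.
  rewrite inE in wD; rewrite mul1r ger0_norm ?lyapunov_ge0//.
  exact: le_trans (ltW (Dl w wD)) (ler_norm l).
- move=> w _; rewrite /h2 /h1 -!mulrA -!mulrDr ler_wpM2l ?indicE ?ler0n//.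
  have := weight_le_potential_drop a0 (V0 w) (VW0 w).
  rewrite (_ : V w + W w - V w = W w); last by ring.
  by move: (wt w); rewrite /lyapunov !expr2; clear; lra.
Qed.

End supermartingale_step.

Section martingale_growth.
Context {d : measure_display} {T : measurableType d} {R : realType}.
Variables (P : probability T R) (F : nat -> set (set T)).
Hypotheses (sF : forall i, sigma_algebra setT (F i))
  (Fm : forall i, F i `<=` measurable)
  (Fmono : forall i j, (i <= j)%N -> F i `<=` F j).
Variables (M W : nat -> T -> R) (a : R).
Hypotheses (a0 : 0 < a) (M_mart : is_martingale1 P F M) (M0 : forall w, M 0 w = 0)
  (W_cond : forall i, (1 <= i)%N ->
    is_condexp P (F i.-1) (fun w => (M i w - M i.-1 w) ^+ 2) (W i))
  (W_ge0 : forall i w, 0 <= W i w).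

Let V n w := \sum_(1 <= i < n.+1) W i w.
Let S n w := lyapunov a (M n w) (V n w).

Lemma sub_measurable_mono i j (X : T -> R) : (i <= j)%N ->
  sub_measurable (F i) X -> sub_measurable (F j) X.
Proof. by move=> ij mX B mB; apply: (Fmono ij); exact: mX. Qed.

Let VS n w : V n.+1 w = V n w + W n.+1 w.
Proof. by rewrite /V big_nat_recr. Qed.

Let V_ge0 n w : 0 <= V n w.
Proof. by rewrite /V sumr_ge0. Qed.

Let sub_V n : sub_measurable (F n.-1) (V n).
Proof.
elim: n => [|n IH].
  apply/sub_measurableP => //; rewrite (_ : V 0 = cst 0)//.
  by apply/funext => w; rewrite /V big_geq.
apply/sub_measurableP => //.
rewrite (_ : V n.+1 = fun w => V n w + W n.+1 w); last first.
  by apply/funext => w; exact: VS.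
apply: measurable_funD; apply/sub_measurableP => //=.
  by apply: sub_measurable_mono IH; exact: leq_pred.
by have [] := W_cond (ltn0Sn n).
Qed.

Let sub_VF n : sub_measurable (F n) (V n).
Proof. by apply: sub_measurable_mono (sub_V n); exact: leq_pred. Qed.

Let sub_S n : (1 <= n)%N -> sub_measurable (F n) (S n).
Proof.
move=> n1; apply/sub_measurableP => //; have [mM _ _] := M_mart.
by apply: measurable_lyapunov; apply/sub_measurableP => //; exact: mM.
Qed.

Fixpoint below (l : R) n : set T :=
  if n is k.+1 then below l k `&` [set w | S k.+1 w < l] else setT.

Let F_below l n : F n (below l n).
Proof.
elim: n => [|n IH] /=; first by rewrite -(g_measurableE (sF 0)); exact: measurableT.
rewrite -(g_measurableE (sF n.+1)); apply: measurableI.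
  by rewrite (g_measurableE (sF n.+1)); exact: (Fmono (leqnSn n)).
have -> : [set w | S n.+1 w < l] = S n.+1 @^-1` `]-oo, l[.
  by apply/seteqP; split => w /=; rewrite in_itv.
by rewrite (g_measurableE (sF n.+1)); apply: sub_S => //; exact: measurable_itv.
Qed.

Let m_below l n : measurable (below l n).
Proof. exact: (Fm (F_below l n)). Qed.

Let below_lt l n w : (1 <= n)%N -> below l n w -> S n w < l.
Proof. by case: n => // n _ []. Qed.

Let Z l n w := \1_(below l n) w * S n w + l * \1_(~` below l n) w.

Let int_indic (A : set T) : measurable A ->
  P.-integrable setT (EFin \o (\1_A : T -> R)).
Proof.
by move=> mA; apply: (integrable_bounded P (M := 1)) => // w; exact: indic_bounded.
Qed.

Let below_step l n : (1 <= n)%N ->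
  P.-integrable setT (EFin \o (fun w => \1_(below l n) w * S n.+1 w)) /\
  \int[P]_w (\1_(below l n) w * S n.+1 w) <= \int[P]_w (\1_(below l n) w * S n w).
Proof.
move=> n1; have [mM iM cM] := M_mart.
rewrite (_ : S n.+1 = fun w => lyapunov a (M n.+1 w) (V n w + W n.+1 w)); last first.
  by apply/funext => w; rewrite /S VS.
apply: (lyapunov_step (sF n) (@Fm n) a0 (cM n n.+1 _) (W_cond (ltn0Sn n)) (sub_VF n)
  (V_ge0 n) (W_ge0 n.+1) (F_below l n)) => //; first by rewrite n1 leqnSn.
by move=> w /below_lt; exact.
Qed.

Let int_Z l n : (1 <= n)%N -> P.-integrable setT (EFin \o Z l n).
Proof.
move=> n1; apply: integrable_EFinD; last first.
  by apply: integrable_EFinZl; apply: int_indic; exact: measurableC.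
have mS := sub_measurable_fun (@Fm n) (sub_S n1).
apply: (integrable_bounded P (M := `|l|)); first exact: measurable_funM.
move=> w; rewrite indicE; case: (boolP (w \in below l n)) => wD; last first.
  by rewrite mul0r normr0.
rewrite inE in wD; rewrite mul1r ger0_norm ?lyapunov_ge0//.
exact: le_trans (ltW (below_lt n1 wD)) (ler_norm l).
Qed.

Let Z_nincr l n : (1 <= n)%N -> \int[P]_w Z l n.+1 w <= \int[P]_w Z l n w.
Proof.
move=> n1; have [iS le_S] := below_step l n1.
have iC : P.-integrable setT (EFin \o (fun w => l * \1_(~` below l n) w)).
  by apply: integrable_EFinZl; apply: int_indic; exact: measurableC.
apply: (@le_trans _ _
    (\int[P]_w (\1_(below l n) w * S n.+1 w + l * \1_(~` below l n) w))).
  apply: le_Rintegral => //; [exact: int_Z|exact: integrable_EFinD|].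
  move=> w _; rewrite /Z !indicE !in_setC /= in_setI.
  case: (boolP (w \in below l n)) => _ /=; last by rewrite !mul0r.
  case: (boolP (w \in _)) => /=; first by rewrite !mul1r.
  by rewrite notin_setE/= => /negP; rewrite -leNgt mul0r mul1r mulr1 mulr0 add0r addr0.
have iZ : P.-integrable setT (EFin \o (fun w => \1_(below l n) w * S n w)).
  have := integrable_EFinB (int_Z l n1) iC.
  rewrite (_ : (fun w => _) = (fun w => \1_(below l n) w * S n w))//.
  by apply/funext => w; rewrite addrK.
rewrite (RintegralD measurableT iS iC) [leRHS](RintegralD measurableT iZ iC).
by rewrite lerD2r.
Qed.

Let K := \int[P]_w (M 1 w ^+ 2 + a^-1).

Let int_K : P.-integrable setT (EFin \o (fun w => M 1 w ^+ 2 + a^-1)).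
Proof.
apply: integrable_EFinD; last exact: integrable_EFin_cst.
have [+ _ _ _] := W_cond (leqnn 1).
rewrite (_ : (fun w => _) = (fun w => M 1 w ^+ 2))//.
by apply/funext => w; rewrite M0 subr0.
Qed.

Let Z_le_K l n : (1 <= n)%N -> \int[P]_w Z l n w <= K.
Proof.
elim: n => // -[_ _|n IH _]; last by apply: (le_trans (Z_nincr _ _)) => //; exact: IH.
apply: le_Rintegral => //; first exact: int_Z.
move=> w _; apply: (@le_trans _ _ (S 1 w)).
  rewrite /Z !indicE in_setC; case: (boolP (w \in _)) => /=.
    by rewrite mul1r mulr0 addr0.
  by rewrite notin_setE/= => /not_andP[//|/negP]; rewrite -leNgt mul0r mulr1 add0r.
by rewrite lerD ?potential_le// ler_piMl ?sqr_ge0 ?weight_le1.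
Qed.

Let maximal_ineq l n : 0 < l -> (1 <= n)%N -> (P (~` below l n) <= (K / l)%:E)%E.
Proof.
move=> l0 n1; have mC := measurableC (m_below l n).
have -> : P (~` below l n) = (\int[P]_w (\1_(~` below l n) w))%:E.
  rewrite /Rintegral integral_indic// setIT fineK// fin_num_measure//.
rewrite lee_fin ler_pdivlMr// mulrC -RintegralZl//; last exact: int_indic.
apply: le_trans (Z_le_K l n1); apply: le_Rintegral => //; [|exact: int_Z|].
  by apply: integrable_EFinZl; exact: int_indic.
by move=> w _; rewrite /Z lerDr mulr_ge0 ?indicE ?ler0n// lyapunov_ge0.
Qed.

Theorem martingale_growth : \forall w \ae P, exists C, forall n, (1 <= n)%N ->
  weight a (\sum_(1 <= i < n.+1) W i w) * M n w ^+ 2 <= C.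
Proof.
pose U (l : R) := \bigcup_n ~` below l n.
have mU l : measurable (U l) by apply: bigcup_measurable => n _; exact: measurableC.
have PU l : 0 < l -> (P (U l) <= (K / l)%:E)%E.
  move=> l0; have cvgU : (P \o (fun n => ~` below l n)) n @[n --> \oo] --> P (U l).
    apply: nondecreasing_cvg_mu; [by move=> n; exact: measurableC|exact: mU|].
    move=> n m /subnK <-; apply/subsetPset/subsetC; elim: (m - n)%N => // k IH.
    by rewrite addSn => w [/IH].
  rewrite -(cvg_lim _ cvgU)//; apply: lime_le; first by apply/cvg_ex; exists (P (U l)).
  by exists 1%N => // n /= n1; exact: maximal_ineq.
pose N := \bigcap_(l : nat) U l.+1%:R.
have mN : measurable N by apply: bigcapT_measurable => l.
have PN : P N = 0%E.
  have fN : (P N = (fine (P N))%:E)%E by rewrite fineK// fin_num_measure.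
  rewrite fN; congr (_%:E); apply/le_anti; rewrite fine_ge0// andbT.
  apply/ler_addgt0Pr => e e0; rewrite add0r.
  pose l := Num.bound `|K / e|.
  have lb : K / e < l.+1%:R.
    apply: (le_lt_trans (ler_norm _)).
    by apply: (lt_trans (archi_boundP (normr_ge0 _))); rewrite ltr_nat.
  have NU : (P N <= P (U l.+1%:R))%E.
    by apply: le_measure; rewrite ?inE//; exact: bigcap_inf.
  have := le_trans NU (PU _ (ltr0Sn R l)); rewrite fN lee_fin => /le_trans; apply.
  by rewrite ler_pdivrMr// mulrC -ler_pdivrMr// ltW.
exists N; split => // w wC l _ /=.
have [n n1 nl] : exists2 n, (1 <= n)%N & l.+1%:R <= S n w.
  apply: contrapT => no; apply: wC; exists l.+1%:R => n n1.
  rewrite leNgt; apply/negP => lS; apply: no; exists n => //.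
  by apply/ltW/(lt_le_trans lS); rewrite lerDl potential_ge0.
by exists n => // /below_lt-/(_ n1); rewrite ltNge nl.
Qed.

End martingale_growth.

Section conditional_variance.
Context {d : measure_display} {T : measurableType d} {R : realType}.
Variable P : probability T R.

(* A conditional expectation of a nonnegative variable is only a.s. nonnegative;
   its positive part is an everywhere nonnegative version. *)
Lemma condexp_pos_part (G : set (set T)) (X Y : T -> R) :
  sigma_algebra setT G -> G `<=` measurable -> (forall w, 0 <= X w) ->
  is_condexp P G X Y ->
  (\forall w \ae P, Num.max (Y w) 0 = Y w) /\
  is_condexp P G X (fun w => Num.max (Y w) 0).
Proof.
move=> sG Gm X0 [iX iY mY XY].
have mYT := sub_measurable_fun Gm mY.
pose A := Y @^-1` `]-oo, 0[.
have GA : G A by apply: mY; exact: measurable_itv.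
have mA := Gm _ GA.
have iYA : P.-integrable A (EFin \o Y) by apply: integrableS iY.
have A0 w : A w -> Y w < 0 by rewrite /A/= in_itv.
have absA : (\int[P]_(w in A) `|(Y w)%:E| = 0)%E.
  apply/eqP; rewrite eq_le; apply/andP; split; last exact: integral_ge0.
  rewrite (eq_integral (fun w => - (Y w)%:E)%E); last first.
    by move=> w; rewrite inE => /A0 Yw; rewrite lte0_abs ?lte_fin.
  rewrite integralN; last exact: integrable_add_def.
  by rewrite leeNl oppe0 XY//; apply: integral_ge0 => w _; rewrite lee_fin.
have /(ae_eq_integral_abs P mA (measurable_int P iYA)) aeA := absA.
have aeY : \forall w \ae P, Num.max (Y w) 0 = Y w.
  apply: filterS aeA => w /= YA; have [//|Yw] := leP 0 (Y w).
  have : (Y w)%:E = 0%E by apply: YA; rewrite /A/= in_itv.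
  by case=> ->.
split => //.
have mmax : measurable_fun setT (fun w => Num.max (Y w) 0) by exact: measurable_maxr.
split => //.
- apply: (le_integrable measurableT _ _ iY) => //; first exact/measurable_EFinP.
  move=> w _; rewrite /= lee_fin.
  by have [_|Yw] := leP 0 (Y w); rewrite // normr0.
- apply/(sub_measurableP sG); apply: measurable_maxr => //.
  exact/(sub_measurableP sG).
- move=> B GB; rewrite -XY//; apply: ae_eq_integral; first exact: Gm.
  + by apply/measurable_EFinP; exact: measurable_funTS.
  + by apply/measurable_EFinP; exact: measurable_funTS.
  + by apply: filterS aeY => w YE _; rewrite YE.
Qed.

Lemma est_funS {p} (u : nat -> 'rV[R]_p -> T -> 'rV[R]_p) n b w :
  est_fun u n.+1 b w = est_fun u n b w + u n.+1 b w.
Proof. by rewrite /est_fun big_nat_recr. Qed.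

Lemma est_fun_growth {p} (F : nat -> set (set T)) (b : 'rV[R]_p)
    (u : nat -> 'rV[R]_p -> T -> 'rV[R]_p) (W : nat -> T -> 'M[R]_p)
    (a : R) (j : 'I_p) :
  complete_filtration P F -> 0 < a ->
  is_martingale1 P F (fun n w => est_fun u n b w 0 j) ->
  (forall i, (1 <= i)%N -> is_condexp P (F i.-1)
     (fun w => ((u i b w)^T *m u i b w) j j) (fun w => W i w j j)) ->
  \forall w \ae P, exists C, forall n, (1 <= n)%N ->
    weight a (cond_var W n w j j) * est_fun u n b w 0 j ^+ 2 <= C.
Proof.
move=> [sF Fm Fmono _] a0 qm Wc.
have uE i w : ((u i b w)^T *m u i b w) j j = u i b w 0 j ^+ 2.
  by rewrite mxE big_ord1 mxE expr2.
have pos i : (1 <= i)%N -> (\forall w \ae P, Num.max (W i w j j) 0 = W i w j j) /\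
  is_condexp P (F i.-1) (fun w => ((u i b w)^T *m u i b w) j j)
    (fun w => Num.max (W i w j j) 0).
  move=> i1; apply: (condexp_pos_part (sF i.-1) (@Fm i.-1) _ (Wc i i1)) => w.
  by rewrite uE sqr_ge0.
have aeW : \forall w \ae P, forall i, Num.max (W i.+1 w j j) 0 = W i.+1 w j j.
  by apply: ae_foralln => i; have [] := pos i.+1 (ltn0Sn i).
have q0 w : est_fun u 0 b w 0 j = 0 by rewrite /est_fun big_geq// mxE.
have W0 i w : 0 <= Num.max (W i w j j) 0 by rewrite le_max lexx orbT.
have Wc' i : (1 <= i)%N -> is_condexp P (F i.-1)
    (fun w => (est_fun u i b w 0 j - est_fun u i.-1 b w 0 j) ^+ 2)
    (fun w => Num.max (W i w j j) 0).
  case: i => // i _; have [_] := pos i.+1 (ltn0Sn i).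
  rewrite (_ : (fun w => ((u i.+1 b w)^T *m u i.+1 b w) j j) =
    (fun w => (est_fun u i.+1 b w 0 j - est_fun u i b w 0 j) ^+ 2))//.
  by apply/funext => w; rewrite uE est_funS mxE addrAC subrr add0r.
have := martingale_growth sF Fm Fmono a0 qm q0 Wc' W0.
apply: filterS2 aeW => w WE [C CP]; exists C => n n1; move: (CP n n1).
rewrite (_ : \sum_(1 <= i < n.+1) _ = cond_var W n w j j)//.
rewrite /cond_var summxE !big_add1; apply: eq_bigr => i _; exact: WE.
Qed.

End conditional_variance.

Section normalization.
Context {R : realType} {p : nat}.

Lemma normalized_cvg0 (x : nat -> 'rV[R]_p) (lam : nat -> R) (a : R) : 0 < a ->
  lam n @[n --> \oo] --> +oo ->
  (forall j, exists C, forall n, (1 <= n)%N -> weight a (lam n) * x n 0 j ^+ 2 <= C) ->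
  lam n `^ (- 2^-1 - a) * enorm (x n) @[n --> \oo] --> 0.
Proof.
move=> a0 lamoo /choice[C CP].
pose K := \sum_j C j * 2 `^ (1 + a).
have bnd n : (1 <= n)%N -> 1 <= lam n ->
    (lam n `^ (- 2^-1 - a) * enorm (x n)) ^+ 2 <= K / lam n `^ a.
  move=> n1 ln; have l0 : 0 < lam n by apply: lt_le_trans ln.
  have l00 := gt_eqF l0.
  have -> : (lam n `^ (- 2^-1 - a) * enorm (x n)) ^+ 2 =
      (\sum_j lam n `^ (- (1 + a)) * x n 0 j ^+ 2) / lam n `^ a.
    rewrite exprMn enorm_sqr dotE -mulr_sumr [RHS]mulrAC; congr (_ * _).
    rewrite expr2 -powRN -!powRD ?l00 ?implybT//.
    congr (_ `^ _); lra.
  rewrite ler_wpM2r ?invr_ge0 ?powR_ge0//.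
  apply: ler_sum => j _; rewrite -ler_pdivrMr ?powR_gt0//; apply: le_trans (CP j n n1).
  rewrite mulrAC ler_wpM2r ?sqr_ge0// /weight !powRN -invfM.
  rewrite lef_pV2 ?posrE ?mulr_gt0 ?powR_gt0 ?addr_gt0// -powRM ?(ltW l0)//.
  rewrite ge0_ler_powR ?nnegrE ?addr_ge0 ?mulr_ge0 ?(ltW l0) ?(ltW a0)//.
  by rewrite mulr_natr mulr2n lerD2r.
apply/cvgr0Pnorm_lt => e e0.
have e2 : 0 < e ^+ 2 by rewrite exprn_gt0.
pose L := (`|K| / e ^+ 2 + 1) `^ a^-1.
have B0 : 0 < `|K| / e ^+ 2 + 1 by rewrite ltr_wpDl// divr_ge0// ltW.
near=> n.
have n1 : (1 <= n)%N by near: n; exact: nbhs_infty_ge.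
have ln1 : 1 <= lam n by near: n; exact: (cvgry_ge lamoo).
have lnL : L <= lam n by near: n; exact: (cvgry_ge lamoo).
rewrite -ltr_sqr ?nnegrE ?(ltW e0)// real_normK ?num_real//.
apply: (le_lt_trans (bnd n n1 ln1)).
rewrite ltr_pdivrMr ?powR_gt0 ?(lt_le_trans _ ln1)//.
apply: (@lt_le_trans _ _ (e ^+ 2 * (`|K| / e ^+ 2 + 1))).
  rewrite mulrDr mulrCA divff ?gt_eqF// !mulr1.
  by rewrite (le_lt_trans (ler_norm K))// ltrDl.
rewrite ler_pM2l//.
have -> : `|K| / e ^+ 2 + 1 = L `^ a by rewrite /L -powRrM mulVf ?gt_eqF// powRr1// ltW.
by rewrite ge0_ler_powR ?nnegrE ?powR_ge0 ?(ltW a0)// (le_trans _ ln1).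
Unshelve. all: by end_near. Qed.

End normalization.

Section first_index.
Context {d : measure_display} {T : measurableType d}.
Implicit Type C : nat -> set T.

(* 0 when w belongs to no C i. *)
Definition first_index C (w : T) : nat :=
  xget 0%N [set i | C i w /\ forall k, (k < i)%N -> ~ C k w].

Lemma first_indexP C w : (exists i, C i w) ->
  C (first_index C w) w /\ forall k, (k < first_index C w)%N -> ~ C k w.
Proof.
move=> [i Ci].
suff /(xgetPex 0%N) : exists k,
  [set i | C i w /\ forall k, (k < i)%N -> ~ C k w] k by [].
have ex : exists i, `[< C i w >] by exists i; apply/asboolP.
have [k /asboolP Ck mink] := ex_minnP ex.
exists k; split => // l lk /asboolP Cl.
by have := mink l Cl; rewrite leqNgt lk.
Qed.

Lemma measurable_first_index C (B : set nat) : (forall i, measurable (C i)) ->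
  measurable (first_index C @^-1` B).
Proof.
move=> mC.
have m1 i : measurable (first_index C @^-1` [set i]).
  pose D := C i `&` ~` \bigcup_(k < i) C k.
  have mD : measurable D.
    apply: measurableI => //; apply: measurableC.
    by apply: bigcup_measurable => k _; exact: mC.
  have mN : measurable (~` \bigcup_k C k).
    by apply: measurableC; apply: bigcup_measurable => k _; exact: mC.
  rewrite (_ : _ @^-1` _ = D `|` (if i == 0%N then ~` \bigcup_k C k else set0)).
    by apply: measurableU => //; case: ifP.
  apply/seteqP; split => w.
    move=> /= fi; have [ex|nex] := pselect (exists i, C i w).
      left; have [Cw min] := first_indexP ex; rewrite fi in Cw min.
      by split => // -[k /= ki Ck]; exact: (min k ki Ck).
    right; rewrite -fi; have -> : first_index C w = 0%N.
      by apply: xgetPN => k [Ck _]; apply: nex; exists k.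
    by move=> [k _ Ck]; apply: nex; exists k.
  move=> [[Ci nC]|].
    have [Cw min] := first_indexP (ex_intro _ i Ci).
    change (first_index C w = i); apply/eqP; rewrite eqn_leq.
    apply/andP; split; rewrite leqNgt; apply/negP => lt.
      exact: (min _ lt Ci).
    by apply: nC; exists (first_index C w).
  case: ifP => [/eqP i0 nC|//]; change (first_index C w = i); rewrite i0.
  by apply: xgetPN => k [Ck _]; apply: nC; exists k.
rewrite (_ : _ @^-1` B = \bigcup_(i in B) (first_index C @^-1` [set i])).
  by apply: bigcup_measurable => k _; exact: m1.
apply/seteqP; split => [w Bw|w [i Bi fi]].
  by exists (first_index C w); [exact: Bw|exact: erefl].
by have {}fi : first_index C w = i := fi; rewrite /preimage/= fi.
Qed.

End first_index.

Section root_selection.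
Context {d : measure_display} {T : measurableType d} {R : realType} {p : nat}.

Definition rat_vector (i : nat) : 'rV[R]_p :=
  if unpickle i is Some v then map_mx ratr (v : 'rV[rat]_p) else 0.

Lemma rat_vector_dense (x : 'rV[R]_p) (U : set 'rV[R]_p) : nbhs x U ->
  exists i, U (rat_vector i).
Proof.
move=> /nbhs_ballP[e /= e0 eU].
have /choice[v vP] : forall j : 'I_p, exists r : rat, `|x 0 j - ratr r| < e.
  move=> j; have [|r] := @rat_in_itvoo R (x 0 j - e) (x 0 j + e).
    by rewrite ltrBlDr -addrA ltrDl addr_gt0.
  by rewrite in_itv/= => /andP[re er]; exists r; rewrite ltr_distlC re er.
exists (pickle (\row_j v j)); rewrite /rat_vector pickleK; apply: eU.
by split => // i j; rewrite ord1 !mxE; exact: vP.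
Qed.

Lemma measurable_enorm (X : T -> 'rV[R]_p) : random_vector X ->
  measurable_fun setT (fun w => enorm (X w)).
Proof.
move=> mX; apply: (measurableT_comp (continuous_measurable_fun (@sqrt_continuous R))).
by apply: measurable_sum => j; exact: measurable_funX.
Qed.

Lemma measurable_root (q : 'rV[R]_p -> T -> 'rV[R]_p) (Par : set 'rV[R]_p)
    (b0 : 'rV[R]_p) (r : T -> R) (G : set T) :
  (forall b, Par b -> random_vector (q b)) -> measurable_fun setT r -> measurable G ->
  (forall w, G w -> eball b0 (r w) `<=` Par) ->
  (forall w x, G w -> eball b0 (r w) x -> q y w @[y --> x] --> q x w) ->
  (forall w x y, G w -> eball b0 (r w) x -> eball b0 (r w) y ->
     q x w = 0 -> q y w = 0 -> x = y) ->
  exists (bhat : T -> 'rV[R]_p) (E : set T),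
    [/\ measurable E /\ E `<=` G, random_vector bhat,
        forall w, E w -> eball b0 (r w) (bhat w) /\ q (bhat w) w = 0,
        forall w, ~ E w -> bhat w = b0 &
        forall w x, G w -> enorm (x - b0) < r w -> q x w = 0 -> E w].
Proof.
move=> mq mr mG GPar qc quniq.
pose dd := rat_vector.
pose C (m i : nat) : set T := [set w | [/\ Par (dd i), enorm (dd i - b0) < r w &
  enorm (q (dd i) w) < m.+1%:R^-1]].
have mC m i : measurable (C m i).
  have [Pd|nPd] := pselect (Par (dd i)); last first.
    rewrite (_ : C m i = set0)//; apply/seteqP; split => // w [].
    by move/nPd.
  rewrite (_ : C m i = (r @^-1` `]enorm (dd i - b0), +oo[) `&`
    ((fun w => enorm (q (dd i) w)) @^-1` `]-oo, m.+1%:R^-1[)); last first.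
    by apply/seteqP; split => w; rewrite /= !in_itv/= ?andbT; [case|case; split].
  apply: measurableI; rewrite -[X in measurable X]setTI.
    by apply: mr => //; exact: measurable_itv.
  by apply: (measurable_enorm (mq _ Pd)) => //; exact: measurable_itv.
pose H := \bigcap_m \bigcup_i C m i.
have mH : measurable H.
  by apply: bigcapT_measurable => m; apply: bigcup_measurable => k _; exact: mC.
pose E := G `&` H; have mE : measurable E by exact: measurableI.
pose a m w := dd (first_index (C m) w).
have aP m w : E w -> C m (first_index (C m) w) w.
  move=> [_ /(_ m I)[i _ Ci]].
  by have [] := @first_indexP _ _ (C m) w (ex_intro _ i Ci).
have ab m w : E w -> eball b0 (r w) (a m w).
  by move=> Ew; have [_ /ltW] := aP m w Ew.
have aq m w : E w -> enorm (q (a m w) w) < m.+1%:R^-1.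
  by move=> Ew; have [] := aP m w Ew.
have cq w : G w -> {within eball b0 (r w), continuous (fun x => enorm (q x w))}.
  move=> Gw; rewrite continuous_subspace_in => x; rewrite inE => xr.
  apply: continuous_subspaceT_for => //.
  apply: (@continuous_comp _ _ _ (fun x => q x w)); first exact: qc.
  exact: continuous_enorm.
have inv_lt (e : R) : 0 < e -> exists m0, forall m, (m0 <= m)%N -> m.+1%:R^-1 < e.
  move=> e0; exists (Num.bound e^-1) => m bm.
  rewrite -[ltRHS]invrK ltf_pV2 ?posrE ?invr_gt0//.
  apply: (lt_le_trans (archi_boundP _)); first by rewrite invr_ge0 ltW.
  by rewrite ler_nat ltnW.
have root w : E w -> exists x, eball b0 (r w) x /\ q x w = 0.
  move=> Ew; have Gw := Ew.1.
  have [||x] := @EVT_min_rV R p (fun x => enorm (q x w)) _ _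
    (@compact_eball R p b0 (r w)).
  - by exists (a 0%N w); exact: ab.
  - exact: cq.
  rewrite inE => xr xmin; exists x; split => //; apply/eqP; rewrite -enorm_eq0.
  apply/negP => /negP x0; have {}x0 : 0 < enorm (q x w) by rewrite lt_def x0 enorm_ge0.
  have [m /(_ m (leqnn m)) mx] := inv_lt _ x0.
  have := xmin (a m w); rewrite inE => /(_ (ab m w Ew)).
  by rewrite leNgt (lt_trans (aq m w Ew)).
pose bhat w := if w \in E then xget b0 [set x | eball b0 (r w) x /\ q x w = 0] else b0.
have bE w : E w -> eball b0 (r w) (bhat w) /\ q (bhat w) w = 0.
  move=> Ew; rewrite /bhat mem_set//.
  by have := xgetPex b0 (root w Ew).
have bN w : ~ E w -> bhat w = b0 by move=> nE; rewrite /bhat memNset.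
have acvg w : E w -> a m w @[m --> \oo] --> bhat w.
  move=> Ew U; rewrite nbhsE => -[V [oV Vb] VU].
  have [br qb] := bE w Ew; have Gw := Ew.1.
  have cK : compact (eball b0 (r w) `&` ~` V).
    by apply: compact_closedI; [exact: compact_eball|exact: open_closedC].
  have [[y Ky]|noK] := pselect (exists y, (eball b0 (r w) `&` ~` V) y); last first.
    exists 0%N => // m _; apply: VU; apply: contrapT => nV; apply: noK; exists (a m w).
    by split => //; exact: ab.
  have [||x] := @EVT_min_rV R p (fun x => enorm (q x w)) _ _ cK.
  - by exists y.
  - by apply: continuous_subspaceW (cq w Gw) => z [].
  rewrite inE => -[xr nVx] xmin.
  have x0 : 0 < enorm (q x w).
    rewrite enorm_gt0; apply/eqP => qx; apply: nVx.
    by rewrite (quniq w x (bhat w) Gw xr br qx qb).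
  have [m0 m0P] := inv_lt _ x0.
  exists m0 => // m /= m0m; apply: VU; apply: contrapT => nV.
  have := xmin (a m w); rewrite inE => /(_ (conj (ab m w Ew) nV)).
  by rewrite leNgt (lt_trans (aq m w Ew))// m0P.
exists bhat, E; split => //.
- by split => // w [].
- move=> j; apply: (@measurable_fun_cvg _ _ _ setT
    (fun m w => \1_E w * (a m w 0 j - b0 0 j) + b0 0 j)).
    move=> m; apply: measurable_funD => //; apply: measurable_funM.
      exact: measurable_indic.
    apply: measurable_funB => //.
    rewrite (_ : (fun w => _) = (fun i => dd i 0 j) \o first_index (C m))//.
    by move=> _ B _; rewrite setTI comp_preimage; exact: measurable_first_index.
  move=> w _; have [Ew|nE] := pselect (E w).
    rewrite (_ : (fun m => _) = (fun m => a m w 0 j)).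
      exact: (cvg_comp _ (fun x : 'rV[R]_p => x 0 j) (acvg w Ew)
        (@coord_continuous _ _ _ _ _ _)).
    by apply/funext => m; rewrite indicE mem_set// mul1r subrK.
  rewrite bN// (_ : (fun m => _) = cst (b0 0 j)); first exact: cvg_cst.
  by apply/funext => m; rewrite indicE memNset// mul0r add0r.
- move=> w x Gw xr qx; split => // m _.
  have : nbhs x [set y | enorm (y - b0) < r w /\ enorm (q y w) < m.+1%:R^-1].
    have xb : eball b0 (r w) x by rewrite /eball/= ltW.
    have c2 := @continuous_comp _ _ _ (fun x => q x w) _ x (qc w x Gw xb)
      (@continuous_enorm R p _).
    near=> y; split; near: y.
      exact: (cvgr_lt _ (@continuous_enormB R p b0 x) _ xr).
    by apply: (cvgr_lt _ c2); rewrite /= qx enorm0 invr_gt0.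
  move=> /rat_vector_dense[i [ir iq]]; exists i => //; split => //.
  by apply: (GPar w Gw); rewrite /eball/= ltW.
Unshelve. all: by end_near. Qed.

End root_selection.

Lemma random_est_fun {d : measure_display} {T : measurableType d} {R : realType} {p}
    (u : nat -> 'rV[R]_p -> T -> 'rV[R]_p) n b :
  (forall i, (1 <= i)%N -> random_vector (u i b)) -> random_vector (est_fun u n b).
Proof.
move=> mu j; have sumE : (fun w => est_fun u n b w 0 j) =
    (fun w => \sum_(i <- index_iota 0 n) u i.+1 b w 0 j).
  by apply/funext => w; rewrite /est_fun summxE big_add1.
by rewrite sumE; apply: measurable_sum => i; exact: mu.
Qed.

Theorem theorem5p3 (R : realType) (d : measure_display) (Omega : measurableType d)
  (P : probability Omega R) (F : nat -> set (set Omega))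
  (p : nat) (Par : set 'rV[R]_p) (beta0 : 'rV[R]_p)
  (u : nat -> 'rV[R]_p -> Omega -> 'rV[R]_p)
  (W : nat -> Omega -> 'M[R]_p)
  (delta : R) (c0 r1 : {RV P >-> R}) (n1 : {RV P >-> nat})
  (p_gt0 : (0 < p)%N)
  (F_filtration : complete_filtration P F)
  (Par_beta0 : Par beta0)
  (u_random : forall i b, (1 <= i)%N -> Par b -> random_vector (u i b))
  (q_C1 : forall n w, (1 <= n)%N -> C1_on Par (fun b => est_fun u n b w))
  (q_martingale : sq_integrable_martingale1 P F (fun n => est_fun u n beta0))
  (q_centered : centered1 P (fun n => est_fun u n beta0))
  (W_condexp : forall i j k, (1 <= i)%N ->
     is_condexp P (F i.-1)
       (fun w => ((u i beta0 w)^T *m u i beta0 w) j k) (fun w => W i w j k))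
  (V_posdef : \forall w \ae P, forall n, (1 <= n)%N -> posdefmx (cond_var W n w))
  (cond_I : \forall w \ae P,
     lambda_min (cond_var W n w) @[n --> \oo] --> +oo)
  (delta_gt0 : 0 < delta)
  (c0_gt0 : \forall w \ae P, 0 < c0 w)
  (n1_ge1 : forall w, (1 <= n1 w)%N)
  (r1_gt0 : \forall w \ae P, 0 < r1 w)
  (r1_ball : \forall w \ae P, eball beta0 (r1 w) `<=` Par)
  (cond_S_i : \forall w \ae P, forall x b n, enorm x = 1 ->
     eball beta0 (r1 w) b -> (n1 w <= n)%N ->
     0 < `|qform (est_deriv u n b w) x|)
  (cond_S_ii : \forall w \ae P,
     limn_esup (fun n =>
       (lambda_max (cond_var W n w) `^ (- 2^-1 - delta))%:E *
       ereal_sup [set (numerical_radius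
                         (est_deriv u n b w - est_deriv u n beta0 w))%:E
                 | b in eball beta0 r])%E @[r --> 0^'+] --> 0%E)
  (cond_S_iii : \forall w \ae P, forall x n, enorm x = 1 -> (n1 w <= n)%N ->
     c0 w <= lambda_max (cond_var W n w) `^ (- 2^-1 - delta) *
             `|qform (est_deriv u n beta0 w) x|) :
  exists (betahat : nat -> Omega -> 'rV[R]_p) (n0 : {RV P >-> nat}),
    [/\ forall n, random_vector (betahat n),
        forall n w, Par (betahat n w),
        (let E := [set w | forall n, (n0 w <= n)%N ->
                     est_fun u n (betahat n w) w = 0] in
         measurable E /\ P E = 1%E)
      & \forall w \ae P, betahat n w @[n --> \oo] --> beta0].
Proof.
have [sF Fm Fmono Fcomplete] := F_filtration.
have nm n b w v : `|qform (est_deriv u n b w) v| =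
    `|qform ('J (fun b' => est_fun u n b' w) b) v|.
  by rewrite /est_deriv qformNtr normrN.
have growth : \forall w \ae P, forall j, exists C, forall n, (1 <= n)%N ->
    weight delta (cond_var W n w j j) * est_fun u n beta0 w 0 j ^+ 2 <= C.
  apply: (@filter_forall _ _ _ (almost_everywhere P)) => j.
  apply: (est_fun_growth F_filtration delta_gt0).
    by have [] := q_martingale j.
  by move=> i i1; exact: W_condexp.
pose goodS w := [/\ forall x b n, enorm x = 1 -> eball beta0 (r1 w) b ->
      (n1 w <= n)%N -> 0 < `|qform (est_deriv u n b w) x|,
    limn_esup (fun n =>
       (lambda_max (cond_var W n w) `^ (- 2^-1 - delta))%:E *
       ereal_sup [set (numerical_radius
                         (est_deriv u n b w - est_deriv u n beta0 w))%:E
                 | b in eball beta0 r])%E @[r --> 0^'+] --> 0%E &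
    forall x n, enorm x = 1 -> (n1 w <= n)%N ->
      c0 w <= lambda_max (cond_var W n w) `^ (- 2^-1 - delta) *
             `|qform (est_deriv u n beta0 w) x|].
pose good w := [/\ forall n, (1 <= n)%N -> posdefmx (cond_var W n w),
  lambda_min (cond_var W n w) @[n --> \oo] --> +oo,
  forall j, exists C, forall n, (1 <= n)%N ->
    weight delta (cond_var W n w j j) * est_fun u n beta0 w 0 j ^+ 2 <= C &
  [/\ 0 < c0 w, 0 < r1 w, eball beta0 (r1 w) `<=` Par & goodS w]].
have [N [mN PN0 goodN]] : \forall w \ae P, good w.
  have ballP : \forall w \ae P, [/\ 0 < c0 w, 0 < r1 w & eball beta0 (r1 w) `<=` Par].
    by apply: filterS3 c0_gt0 r1_gt0 r1_ball => w; split.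
  have aeS : \forall w \ae P, goodS w.
    by apply: filterS3 cond_S_i cond_S_ii cond_S_iii => w; split.
  apply: filterS3 growth (filterI V_posdef cond_I) (filterI ballP aeS).
  by move=> w ? [? ?] [[? ? ?] ?]; split => //; split.
pose G := ~` N.
have mG : measurable G by exact: measurableC.
have Ggood w : G w -> good w.
  by move=> nN; apply: contrapT => ng; apply: nN; exact: goodN.
have m_n1 n : measurable [set w | (n1 w <= n)%N].
  rewrite (_ : [set w | _] = n1 @^-1` [set k | (k <= n)%N])// -[X in measurable X]setTI.
  exact: measurable_funPT.
have sel n : exists (bhat : Omega -> 'rV[R]_p) (E : set Omega),
    [/\ measurable E /\ E `<=` G `&` [set w | (n1 w <= n)%N], random_vector bhat,
      forall w, E w -> eball beta0 (r1 w) (bhat w) /\ est_fun u n (bhat w) w = 0,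
      forall w, ~ E w -> bhat w = beta0 &
      forall w x, (G `&` [set w | (n1 w <= n)%N]) w -> enorm (x - beta0) < r1 w ->
        est_fun u n x w = 0 -> E w].
  apply: (measurable_root (Par := Par)).
  - by move=> b Pb; apply: random_est_fun => i i1; exact: u_random.
  - exact: measurable_funPT.
  - exact: measurableI.
  - by move=> w [/Ggood[_ _ _ [_ _ rP _]] _].
  - move=> w x [/Ggood[_ _ _ [_ _ rP _]] nw] xr.
    have n_ge1 : (1 <= n)%N := leq_trans (n1_ge1 w) nw.
    exact/differentiable_continuous/(q_C1 n w n_ge1).1/rP.
  - move=> w x y [/Ggood[_ _ _ [_ _ rP [Si _ _]]] nw].
    have n_ge1 : (1 <= n)%N := leq_trans (n1_ge1 w) nw.
    apply: (root_unique (f := fun b => est_fun u n b w)).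
      by move=> z zr; apply: (q_C1 n w n_ge1).1; exact: rP.
    by move=> z v zr v1; have := Si v z n v1 zr nw; rewrite nm normr_gt0.
have /choice[bhat /choice[E bhatP]] := sel.
have root_ev w (r : R) : G w -> 0 < r -> \forall n \near \oo, exists x,
    [/\ enorm (x - beta0) < r1 w, enorm (x - beta0) < r & est_fun u n x w = 0].
  move=> Gw r0; have [pd lmin gr [c0w r1w rP [Si Sii Siii]]] := Ggood w Gw.
  apply: (@eventually_root R p (fun n b => est_fun u n b w)
    (fun n => lambda_max (cond_var W n w) `^ (- 2^-1 - delta))
    (fun n b => est_deriv u n b w) beta0 (c0 w) (r1 w) (n1 w)) => //.
  - move=> n nw; apply: powR_gt0; apply: lambda_max_gt0 => //; apply: pd.
    exact: leq_trans (n1_ge1 w) nw.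
  - move=> n x nw xr; apply: (q_C1 n w _).1; first exact: leq_trans (n1_ge1 w) nw.
    exact: rP.
  - apply: normalized_cvg0 => //.
      apply: ger_cvgy lmin; exists 1%N => // n /= n_ge1.
      exact: lambda_min_le_max (pd n n_ge1).
    move=> j; have [C CP] := gr j; exists C => n n_ge1.
    have [Vt Vpd] := pd n n_ge1.
    apply: le_trans (CP n n_ge1); rewrite ler_wpM2r ?sqr_ge0// weight_nincr//.
      rewrite -qform_delta ltW// Vpd// -enorm_eq0 enorm_delta oner_neq0//.
    exact: diag_le_lambda_max.
have E_ev w : G w -> \forall n \near \oo, E n w.
  move=> Gw; have := root_ev w 1 Gw ltr01.
  apply: filterS2 (nbhs_infty_ge (n1 w)) => n nw [x [xr _ qx]].
  by have [_ _ _ _] := bhatP n; apply; [split|exact: xr|exact: qx].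
pose C k := \bigcap_(n in [set n | (k <= n)%N]) E n.
have mC k : measurable (C k).
  apply: bigcap_measurable => [|n _]; first by exists k => /=.
  by have [[]] := bhatP n.
have mn0 : measurable_fun setT (first_index C).
  by move=> _ B _; rewrite setTI; exact: measurable_first_index.
pose n0 : {RV P >-> nat} :=
  HB.pack (first_index C) (isMeasurableFun.Build _ _ _ _ (first_index C) mn0).
exists bhat, n0; split.
- by move=> n; have [] := bhatP n.
- move=> n w; have [[_ EG] _ bE bN _] := bhatP n.
  have [Ew|nE] := pselect (E n w); last by rewrite bN.
  have [/Ggood[_ _ _ [_ _ rP _]] _] := EG w Ew.
  by apply: rP; have [] := bE w Ew.
- pose E0 := [set w | forall n, (n0 w <= n)%N -> est_fun u n (bhat n w) w = 0].
  have GE0 : G `<=` E0.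
    move=> w Gw n n0n.
    have [k _ kE] := E_ev w Gw.
    have [Cw _] := @first_indexP _ _ C w (ex_intro _ k kE).
    by have [_ _ bE _ _] := bhatP n; have [] := bE w (Cw n n0n).
  have negE0 : P.-negligible (~` E0).
    by exists N; split => // w nE; apply: contrapT => nN; apply: nE; exact: GE0.
  have mE0' : measurable (~` E0) by apply: (@Fm 0%N); exact: Fcomplete.
  have mE0 : measurable E0 by rewrite -[E0]setCK; exact: measurableC.
  split => //; rewrite -[X in P X]setCK probability_setC//.
  by have /negligibleP -> := negE0; rewrite ?sube0.
- have aeG : \forall w \ae P, G w by exists N; split => //; rewrite setCK.
  apply: filterS aeG => w Gw; apply/cvgrPdist_lt => e e0.
  have := root_ev w e Gw e0.
  apply: filterS2 (E_ev w Gw) => n Ew [x [xr xe qx]].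
  have [[_ EG] _ bE _ _] := bhatP n; have [br bq] := bE w Ew.
  have [/Ggood[_ _ _ [_ _ rP [Si _ _]]] nw] := EG w Ew.
  have n_ge1 : (1 <= n)%N := leq_trans (n1_ge1 w) nw.
  have -> : bhat n w = x.
    apply: (@root_unique R p (fun b => est_fun u n b w) beta0 (r1 w)) => //.
    + by move=> z zr; apply: (q_C1 n w n_ge1).1; exact: rP.
    + by move=> z v zr v1; have := Si v z n v1 zr nw; rewrite nm normr_gt0.
    + by rewrite /eball/= ltW.
  by rewrite distrC; apply: le_lt_trans xe; exact: norm_le_enorm.
Qed.
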